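(* Let $\mathscr{H}$ be a complex Hilbert space of arbitrary dimension, let $A,B\in\mathbb{B}(\mathscr{H})$ be positive operators, and let $t\in\mathbb{R}$ with $t\le 2$ and $r\in[\frac12,\frac32]$. Let $|||\cdot|||$ be any unitarily invariant norm, with associated norm ideal $\mathfrak{J}_{|||\cdot|||}$, and let $X\in\mathfrak{J}_{|||\cdot|||}$. For $s\in[\frac12,\frac32]$ write $$h(s)=|||A^{s}XB^{2-s}+A^{2-s}XB^{s}|||.$$ Then the following chains of inequalities hold. (1) If $r\in[\frac12,1]$, then $$\begin{aligned} 2\,|||A^2X+XB^2+tAXB||| &\ge 2\,|||A^2X+XB^2+2AXB|||-(4-2t)\,|||AXB|||\\ &\ge 4\,h(\tfrac32)-(4-2t)\,|||AXB|||\\ &\ge 2\,h(\tfrac32)+2\,h(r)-(4-2t)\,|||AXB|||\\ &\ge \frac{4}{r-\frac12}\int_0^{r-\frac12}h(\nu+\tfrac12)\,d\nu-(4-2t)\,|||AXB|||\\ &\ge 4\,h\!\left(\tfrac{2r+1}{4}\right)-(4-2t)\,|||AXB|||\\ &\ge 4\,h(r)-(4-2t)\,|||AXB|||\\ &\ge (t+2)\,h(r). \end{aligned}$$ (2) If $r\in[1,\frac32]$, then $$\begin{aligned} 2\,|||A^2X+XB^2+tAXB||| &\ge 2\,|||A^2X+XB^2+2AXB|||-(4-2t)\,|||AXB|||\\ &\ge 4\,h(\tfrac32)-(4-2t)\,|||AXB|||\\ &\ge 2\,h(\tfrac32)+2\,h(r)-(4-2t)\,|||AXB|||\\ &\ge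 \frac{4}{\frac32-r}\int_{r-\frac12}^{1}h(\nu+\tfrac12)\,d\nu-(4-2t)\,|||AXB|||\\ &\ge 4\,h\!\left(\tfrac{2r+3}{4}\right)-(4-2t)\,|||AXB|||\\ &\ge 4\,h(r)-(4-2t)\,|||AXB|||\\ &\ge (t+2)\,h(r). \end{aligned}$$ At the endpoints $r=\frac12$ in (1) and $r=\frac32$ in (2), the averaged integral $\frac{1}{r-\frac12}\int_0^{r-\frac12}h(\nu+\frac12)\,d\nu$, respectively $\frac{1}{\frac32-r}\int_{r-\frac12}^{1}h(\nu+\frac12)\,d\nu$, is understood as its limit as $r\to\frac12^+$, respectively $r\to\frac32^-$.
   Context: $\mathbb{B}(\mathscr{H})$ is the algebra of bounded linear operators on $\mathscr{H}$; ''positive'' means positive semidefinite (self-adjoint with nonnegative spectrum, not necessarily invertible), and real powers of positive operators are given by the functional calculus. A unitarily invariant norm $|||\cdot|||$ is a norm defined on an associated norm ideal $\mathfrak{J}_{|||\cdot|||}$ of $\mathbb{B}(\mathscr{H})$ (in the usual sense: a two-sided ideal, complete in $|||\cdot|||$) such that $|||UXV|||=|||X|||$ for all unitaries $U,V$ and all $X\in\mathfrak{J}_{|||\cdot|||}$. The operator norm, with ideal $\mathbb{B}(\mathscr{H})$, and the Schatten $p$-norms are examples. *)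

(* Defs.v *)
From HB Require Import structures.
From mathcomp Require Import all_boot all_order all_algebra.
From mathcomp Require Import all_classical all_reals all_analysis.
From mathcomp Require Import complex sesquilinear.

Set Implicit Arguments.
Unset Strict Implicit.
Unset Printing Implicit Defensive.

Import Order.TTheory GRing.Theory Num.Theory.
Import numFieldNormedType.Exports.

Local Open Scope classical_set_scope.
Local Open Scope ring_scope.
Local Open Scope complex_scope.

(* The inner product is linear in its first argument and conjugate-linear in
   its second one. *)
HB.mixin Record CompleteNormedModule_isHilbert (R : realType) (H : Type)
    of CompleteNormedModule R[i] H := {
  inner : {dot H for (@Num.conj R[i])} ;
  inner_normE : forall x : H, `|x| ^+ 2 = inner x x }.

#[short(type="hilbertType")]
HB.structure Definition Hilbert (R : realType) :=
  {H of CompleteNormedModule R[i] H & CompleteNormedModule_isHilbert R H}.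

Section Operators.
Context {R : realType} {H : hilbertType R}.
Implicit Types (A S T U V X Y : H -> H) (f : R -> R) (p : {poly R}).

Definition bounded_op : set (H -> H) :=
  [set T | linear T /\ exists M : R, forall x, `|T x| <= M%:C * `|x|].

(* The norm of a normed space over R[i] takes its values in R[i]. *)
Definition opnorm T : R := sup [set complex.Re `|T x| | x in [set x | `|x| <= 1]].

Definition adjoint_op S T := forall x y : H, inner (S x) y = inner x (T y).

Definition unitary_op U :=
  bounded_op U /\
  exists V, [/\ bounded_op V, adjoint_op U V, U \o V = id & V \o U = id].

Definition spectrum A : set R[i] :=
  [set z | ~ exists T, [/\ bounded_op T,
     T \o (A - z *: id) = id & (A - z *: id) \o T = id]].

Definition positive_op A :=
  [/\ bounded_op A, adjoint_op A A & forall z, spectrum A z -> 0 <= z].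

Definition op_horner p A : H -> H :=
  \sum_(i < size p) (p`_i)%:C *: iter i A.

(* Continuous functional calculus of a self-adjoint operator: [f] being
   continuous on the (real) spectrum of [A], [op_fun f A] is the operator norm
   limit of [p_n(A)] for real polynomials [p_n] converging to [f] uniformly on
   the spectrum. The limit exists and does not depend on the [p_n], by the
   Weierstrass theorem and the identity between the norm of [p(A)] and the
   supremum of [|p|] on the spectrum. Boundedness of [T] has to be required
   because [sup] is 0 on unbounded sets. *)
Definition is_op_fun f A T :=
  bounded_op T /\
  exists p_ : nat -> {poly R},
    {uniform [set x : R | spectrum A x%:C],
       (fun n x => (p_ n).[x]) @ \oo --> f} /\
    opnorm (op_horner (p_ n) A - T) @[n --> \oo] --> (0 : R).

Definition op_fun f A : H -> H := xget 0 [set T | is_op_fun f A T].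

Definition op_pow A (s : R) : H -> H := op_fun (fun x => x `^ s) A.

Record norm_ideal (J : set (H -> H)) (N : (H -> H) -> R) : Prop := NormIdeal {
  ideal_bounded : J `<=` bounded_op ;
  ideal0 : J 0 ;
  ideal_linear : forall (c : R[i]) X Y, J X -> J Y -> J (c *: X + Y) ;
  ideal_comp : forall S T X,
    bounded_op S -> bounded_op T -> J X -> J (S \o X \o T) ;
  ideal_norm_eq0 : forall X, J X -> N X = 0 -> X = 0 ;
  ideal_normZ : forall (c : R[i]) X, J X -> N (c *: X) = complex.Re `|c| * N X ;
  ideal_normD : forall X Y, J X -> J Y -> N (X + Y) <= N X + N Y ;
  ideal_complete : forall X_ : nat -> H -> H, (forall n, J (X_ n)) ->
    (forall e : R, 0 < e -> exists n0 : nat, forall m n : nat,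
      (n0 <= m)%N -> (n0 <= n)%N -> N (X_ m - X_ n) < e) ->
    exists2 Y, J Y & N (X_ n - Y) @[n --> \oo] --> (0 : R) }.

Definition unitarily_invariant_norm (J : set (H -> H)) (N : (H -> H) -> R) :=
  norm_ideal J N /\
  forall U V X, unitary_op U -> unitary_op V -> J X -> N (U \o X \o V) = N X.

Definition heinz_norm (N : (H -> H) -> R) A B X (s : R) : R :=
  N ((op_pow A s \o X \o op_pow B (2 - s)) +
     (op_pow A (2 - s) \o X \o op_pow B s)).

End Operators.

Section Means.
Context {R : realType}.
Implicit Types (h : R -> R) (r : R).

Definition mean_left_quot h r : R :=
  (r - 1 / 2)^-1 *
  \int[lebesgue_measure]_(nu in `[0, r - 1 / 2]) h (nu + 1 / 2).

Definition mean_left h r : R :=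
  if r == 1 / 2 then lim (mean_left_quot h u @[u --> at_right (1 / 2 : R)])
  else mean_left_quot h r.

Definition mean_right_quot h r : R :=
  (3 / 2 - r)^-1 *
  \int[lebesgue_measure]_(nu in `[r - 1 / 2, 1]) h (nu + 1 / 2).

Definition mean_right h r : R :=
  if r == 3 / 2 then lim (mean_right_quot h u @[u --> at_left (3 / 2 : R)])
  else mean_right_quot h r.

End Means.

(* Main.v *)
(** Everything reduces to the inequality [2 |||P Y Q||| <= |||P^2 Y + Y Q^2|||]
for [P = f(A)] and [Q = g(B)] with [f, g >= 0]. It gives midpoint convexity of
[h] on [[0, 2]] (take [P = A^d], [Q = B^d]), and since [h] is bounded there it is
convex, hence continuous inside; the integral inequalities are then those of
Hermite and Hadamard. With [Y = AX + XB] and [P, Q] the square roots it also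
gives [2 h(3/2) <= |||A^2 X + X B^2 + 2 A X B|||].

For positive definite [P, Q], put [W = P Y Q] and let [D] be the derivation
[D Z = (ln P) Z - Z (ln Q)]; then [P^2 Y + Y Q^2 = 2 cosh(D) W]. The polynomial
[(1 + x)^n + (1 - x)^n] has only imaginary roots, so at [x = D/n] it factors as
[2] times a product of maps [1 + i l D] with [l] real. Each of these does not
decrease the norm, because [i D] generates a group of isometries
[Z -> U Z V] with [U, V] unitary. Letting [n] tend to infinity gives
[2 |||W||| <= ||| 2 cosh(D) W |||]. *)
Require Import Defs.
From HB Require Import structures.
From mathcomp Require Import all_boot all_order all_algebra.
From mathcomp Require Import all_classical all_reals all_analysis.
From mathcomp Require Import complex sesquilinear.
From mathcomp Require Import ring lra.
Set Implicit Arguments.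
Unset Strict Implicit.
Unset Printing Implicit Defensive.
Import Order.TTheory GRing.Theory Num.Theory.
Import numFieldNormedType.Exports.
Local Open Scope classical_set_scope.
Local Open Scope ring_scope.
Local Open Scope complex_scope.

(** * Weierstrass approximation *)

Section Weierstrass.
Context {R : realType}.
Implicit Types (f g : R -> R) (F G : nat -> R) (x c e : R) (p : {poly R}).

(** The axioms of [norm_ideal] do not compare [N] with the operator norm, so every estimate has to
    pass through unitary invariance. The unitaries used are [f(A) + i g(A)] with [f^2 + g^2 = 1] on
    the spectrum. The mean of two of them represents any contraction [f(A)], which bounds
    multiplication by functions of [A] or [B]; those with small [g] replace the one-parameter group
    of isometries, one of the two parts being simply a square root. [op_fun] selects an operator
    only when polynomial approximation on the spectrum defines one. Existence and uniqueness rest on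
    the Weierstrass theorem and on the bound of [p(A)] by the supremum of [|p|] on the spectrum,
    which is derived here from the definition of the spectrum as non-invertibility. The logarithm is
    available only for positive definite operators, hence a final shift by a small multiple of the
    identity. The parameter [t] enters only at the two ends of the chains: the triangle inequality
    gives the first link, and the last one holds because [h(1) = 2 |||AXB|||] is the minimum of
    [h]. *)

Lemma unif_continuous_itv f (M e : R) : continuous f -> 0 < e ->
  exists2 d : R, 0 < d & forall x y, 0 <= x <= M -> `|x - y| < d ->
    `|f x - f y| < e.
Proof.
move=> cf e0.
have loc (x : R) : exists2 d : R, 0 < d & forall x' y : R,
    `|x - x'| < d -> `|x' - y| < d -> `|f x' - f y| < e.
  have e20 : 0 < e / 2 by lra.
  have /cvgrPdist_lt /(_ _ e20)/nbhs_ballP[d d0' fd] := cf x.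
  have d0 : 0 < d by exact: d0'.
  have fd' (y : R) : `|x - y| < d -> `|f x - f y| < e / 2 by exact: fd.
  exists (d / 2); first by lra.
  move=> x' y xx' x'y.
  have h1 : `|f x - f x'| < e / 2 by apply: fd'; lra.
  have h2 : `|f x - f y| < e / 2.
    by apply: fd'; apply: (le_lt_trans (ler_distD x' x y)); lra.
  by have := ler_distD (f x) (f x') (f y); rewrite (distrC (f x') (f x)); lra.
have /compact_near_coveringP cov :
  compact (`[0, M]%classic : set R) by exact: segment_compact.
have := cov _ (0^'+ : set_system R)
  (fun d x => forall y, `|x - y| < d -> `|f x - f y| < e) _ _.
case => [x _|].
  have [d d0 hd] := loc x.
  exists (ball x d, [set t | t < d]).
    split => /=; first by apply/nbhs_ballP; exists d.
    exact: nbhs_right_lt.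
  by move=> [x' t] /= [xx' td] y x'y; apply: hd => //; exact: lt_trans td.
move=> d d0' H; have d0 : 0 < d by exact: d0'.
have d2 : 0 < d / 2 by lra.
exists (d / 2) => //.
move=> x y xM xy; apply: (H (d / 2)) => //=; rewrite ?in_itv //=.
rewrite /ball/= sub0r normrN gtr0_norm; lra.
Qed.

(* [(bernstein n F).[x]] is the expectation of [F] under the binomial law with
   parameters [n] and [x]. *)
Fixpoint bernstein n F : {poly R} :=
  if n is m.+1 then 'X * bernstein m (F \o S) + (1 - 'X) * bernstein m F
  else (F 0%N)%:P.

Lemma bernsteinS n F x : (bernstein n.+1 F).[x] =
  x * (bernstein n (F \o S)).[x] + (1 - x) * (bernstein n F).[x].
Proof. by rewrite /= !hornerE. Qed.

Lemma bernstein_le n F G x : 0 <= x <= 1 ->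
  (forall k, (k <= n)%N -> F k <= G k) ->
  (bernstein n F).[x] <= (bernstein n G).[x].
Proof.
move=> /andP[x0 x1]; elim: n F G => [|n IH] F G FG.
  by rewrite /= !hornerE; exact: FG.
rewrite !bernsteinS lerD// ler_wpM2l ?subr_ge0//; apply: IH => k kn.
  exact: FG.
by apply: FG; exact: leqW.
Qed.

Lemma bernsteinD n F G x :
  (bernstein n (fun k => F k + G k)).[x] =
  (bernstein n F).[x] + (bernstein n G).[x].
Proof.
elim: n F G => [|n IH] F G; first by rewrite /= !hornerE.
rewrite !bernsteinS IH [in X in x * X](_ : _ \o _ = fun k => (F \o S) k + (G \o S) k)//.
rewrite IH; ring.
Qed.

Lemma bernsteinZ n c F x :
  (bernstein n (fun k => c * F k)).[x] = c * (bernstein n F).[x].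
Proof.
elim: n F => [|n IH] F; first by rewrite /= !hornerE.
rewrite !bernsteinS IH [in X in x * X](_ : _ \o _ = fun k => c * (F \o S) k)//.
rewrite IH; ring.
Qed.

Lemma bernstein_cst n c x : (bernstein n (fun=> c)).[x] = c.
Proof.
elim: n => [|n IH]; first by rewrite /= !hornerE.
by rewrite bernsteinS !IH; ring.
Qed.

(** Squared distance of the mean from [c], plus the variance. Leaving [c] arbitrary is what makes
    the induction work: a success in the first trial moves the centre to [c - 1]. *)
Lemma bernstein_variance n c x :
  (bernstein n (fun k => (k%:R - c) ^+ 2)).[x] =
  (n%:R * x - c) ^+ 2 + n%:R * x * (1 - x).
Proof.
elim: n c => [|n IH] c; first by rewrite /= !hornerE /=; ring.
rewrite bernsteinS IH [in X in x * X](_ : _ \o _ = fun k => (k%:R - (c - 1)) ^+ 2).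
  by rewrite IH -natr1; ring.
by apply/funext => k /=; rewrite -natr1; ring.
Qed.

Lemma bernstein_approx f e : continuous f -> 0 < e ->
  exists p, forall x, 0 <= x <= 1 -> `|f x - p.[x]| <= e.
Proof.
move=> cf e0; have e2 : 0 < e / 2 by lra.
have [d d0 fd] := unif_continuous_itv 1 cf e2.
have [G G0 fG] : exists2 G : R, 0 < G & forall x, 0 <= x <= 1 -> `|f x| <= G.
  have cn : {within `[0, 1], continuous (fun x => `|f x|)}.
    apply: continuous_subspaceT => x.
    by apply: continuous_comp; [exact: cf|exact: norm_continuous].
  have [m _ hm] := EVT_max (@ler01 R) cn.
  exists (`|f m| + 1); first by rewrite ltr_wpDl.
  by move=> x x01; have := hm x; rewrite in_itv /= => /(_ x01); lra.
(* This [n] makes [2 * G / (d ^+ 2 * n%:R)], the tail term of Chebyshev's inequality, at most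
   [e / 2]. *)
have [n n0 hn] : exists2 n : nat, (0 < n)%N & 2 * G <= e / 2 * (d ^+ 2 * n%:R).
  have c0 : 0 < e / 2 * d ^+ 2 by rewrite mulr_gt0// exprn_gt0.
  exists (Num.truncn (2 * G / (e / 2 * d ^+ 2))).+1 => //.
  rewrite mulrA -ler_pdivrMl// mulrC ltW//.
  by rewrite truncnS_gt.
exists (bernstein n (fun k => f (k%:R / n%:R))) => x x01.
have nR : 0 < n%:R :> R by rewrite ltr0n.
(* Chebyshev's argument as a pointwise majorant: within [d] of [x] the term [e / 2] suffices, and
   farther away the quotient of [(k - n x)^2] by [(d n)^2] is at least 1, so that the crude bound
   [2 * G] applies. The expectation of [K] is given by [bernstein_variance]. *)
pose K k : R := e / 2 + 2 * G / (d ^+ 2 * n%:R ^+ 2) * (k%:R - n%:R * x) ^+ 2.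
have K0 k : 0 <= 2 * G / (d ^+ 2 * n%:R ^+ 2) * (k%:R - n%:R * x) ^+ 2.
  by rewrite mulr_ge0 ?sqr_ge0// divr_ge0 ?mulr_ge0 ?ltW// ?exprn_gt0.
have hK k : (k <= n)%N -> `|f x - f (k%:R / n%:R)| <= K k.
  move=> kn; have [xd|xd] := ltP `|x - k%:R / n%:R| d.
    by have := fd _ _ x01 xd; have := K0 k; rewrite /K; lra.
  have k01 : 0 <= (k%:R / n%:R : R) <= 1.
    by rewrite divr_ge0//= ler_pdivrMr// mul1r ler_nat.
  have := ler_normB (f x) (f (k%:R / n%:R)).
  have := fG _ x01; have := fG _ k01.
  suff : 2 * G <= 2 * G / (d ^+ 2 * n%:R ^+ 2) * (k%:R - n%:R * x) ^+ 2.
    rewrite /K; lra.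
  have dn0 : 0 < d * n%:R by rewrite mulr_gt0.
  rewrite -mulrA ler_peMr//; first by rewrite mulr_ge0// ltW.
  rewrite mulrC ler_pdivlMr ?mul1r; last by rewrite -exprMn exprn_gt0.
  rewrite -exprMn -(real_normK (num_real (_ - _))) lerXn2r ?nnegrE// ?(ltW dn0)//.
  have -> : k%:R - n%:R * x = n%:R * (k%:R / n%:R - x) by field; rewrite gt_eqF.
  rewrite normrM gtr0_norm// mulrC ler_pM2l// distrC.
  exact: xd.
have bK : (bernstein n K).[x] <= e.
  rewrite bernsteinD bernstein_cst bernsteinZ bernstein_variance subrr.
  rewrite expr0n /= add0r.
  have x14 : x * (1 - x) <= 1 by nra.
  have : 2 * G / (d ^+ 2 * n%:R ^+ 2) * (n%:R * x * (1 - x)) <=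
      2 * G / (d ^+ 2 * n%:R ^+ 2) * n%:R.
    apply: ler_wpM2l; first by rewrite ltW// divr_gt0// ?mulr_gt0 ?exprn_gt0.
    by rewrite -mulrA -[leRHS]mulr1 ler_wpM2l// ltW.
  have -> : 2 * G / (d ^+ 2 * n%:R ^+ 2) * n%:R = 2 * G / (d ^+ 2 * n%:R).
    by field; rewrite !gt_eqF.
  have : 2 * G / (d ^+ 2 * n%:R) <= e / 2.
    by rewrite ler_pdivrMr ?mulr_gt0 ?exprn_gt0.
  lra.
apply: le_trans bK.
have -> : f x = (bernstein n (fun=> f x)).[x] by rewrite bernstein_cst.
have -> : (bernstein n (fun=> f x)).[x] -
    (bernstein n (fun k => f (k%:R / n%:R))).[x] =
    (bernstein n (fun k => f x + -1 * f (k%:R / n%:R))).[x].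
  by rewrite bernsteinD bernsteinZ; ring.
rewrite ler_norml; apply/andP; split.
  have -> : - (bernstein n K).[x] = (bernstein n (fun k => -1 * K k)).[x].
    by rewrite bernsteinZ mulN1r.
  apply: bernstein_le => // k /hK.
  by rewrite ler_norml => /andP[]; lra.
apply: bernstein_le => // k /hK.
by rewrite ler_norml => /andP[]; lra.
Qed.

Lemma weierstrass f (M e : R) : continuous f -> 0 < M -> 0 < e ->
  exists p, forall x, 0 <= x <= M -> `|f x - p.[x]| <= e.
Proof.
move=> cf M0 e0.
have [||p hp] := @bernstein_approx (fun x => f (M * x)) e => //.
  move=> x; apply: continuous_comp; last exact: cf.
  exact: mulrl_continuous.
exists (p \Po (M^-1 *: 'X)) => x /andP[x0 xM].
rewrite horner_comp !hornerE.
have := hp (M^-1 * x); rewrite mulrA divff ?gt_eqF// mul1r; apply.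
apply/andP; split; first by rewrite mulr_ge0// invr_ge0 ltW.
by rewrite mulrC ler_pdivrMr// mul1r.
Qed.

End Weierstrass.

(** * Convex functions of a real variable *)

Section ConvexFunctions.
Context {R : realType}.
Implicit Types (g h : R -> R) (a b l x y : R).

Definition convex_on h a b := forall x y l, a <= x <= b -> a <= y <= b ->
  0 <= l <= 1 -> h (l * x + (1 - l) * y) <= l * h x + (1 - l) * h y.

(* The excess of [h] over its chord is at most doubled when the distance to the
   nearest endpoint is doubled; being bounded, it cannot be positive. *)
Lemma midpoint_convex_bounded h a b (C : R) :
  (forall x, a <= x <= b -> `|h x| <= C) ->
  (forall x y, a <= x <= b -> a <= y <= b ->
    2 * h ((x + y) / 2) <= h x + h y) ->
  convex_on h a b.
Proof.
move=> hC hmid x y l xab yab l01.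
pose p m := m * x + (1 - m) * y.
pose phi m := h (p m) - (m * h x + (1 - m) * h y).
have pab m : 0 <= m <= 1 -> a <= p m <= b.
  by rewrite /p => m01; apply/andP; split; nra.
have phi0 : phi 0 = 0 by rewrite /phi /p !mul0r !add0r subr0 !mul1r subrr.
have phi1 : phi 1 = 0.
  by rewrite /phi /p !mul1r subrr !mul0r !addr0 subrr.
have phi_mid m m' : 0 <= m <= 1 -> 0 <= m' <= 1 ->
    2 * phi ((m + m') / 2) <= phi m + phi m'.
  move=> hm hm'; have := hmid _ _ (pab _ hm) (pab _ hm').
  rewrite /phi; have -> : (p m + p m') / 2 = p ((m + m') / 2).
    by rewrite /p; field.
  by move=> H; nra.
have bound n m : 0 <= m <= 1 -> phi m * 2 ^+ n <= 2 * C.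
  elim: n m => [|n IH] m m01.
    rewrite expr0 mulr1 /phi.
    have := hC _ (pab _ m01); have := hC _ xab; have := hC _ yab.
    rewrite !ler_norml => /andP[? ?] /andP[? ?] /andP[? ?].
    nra.
  have e2 : 0 < 2 ^+ n :> R by rewrite exprn_gt0.
  rewrite exprS mulrA (mulrC (phi m)).
  have [m2|m2] := lerP m (1 / 2).
    have h2 : 0 <= 2 * m <= 1 by lra.
    have := phi_mid (2 * m) 0 h2; rewrite addr0 phi0 addr0.
    have -> : 2 * m / 2 = m by field.
    have := IH _ h2; move=> + /(_ _); rewrite lexx ler01 => + /(_ isT).
    nra.
  have h2 : 0 <= 2 * m - 1 <= 1 by lra.
  have := phi_mid (2 * m - 1) 1 h2; rewrite subrK phi1 addr0.
  have -> : 2 * m / 2 = m by field.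
  have := IH _ h2; move=> + /(_ _); rewrite lexx ler01 => + /(_ isT).
  nra.
rewrite -subr_le0 -/(phi l) leNgt; apply/negP => phi_gt0.
pose n := (Num.truncn (2 * C / phi l)).+1.
have := bound n l l01; rewrite -ler_pdivlMl// mulrC => hn.
have : 2 * C / phi l < n%:R by exact: truncnS_gt.
have : n%:R <= 2 ^+ n :> R by rewrite -natrX ler_nat ltnW// ltn_expl.
lra.
Qed.

(** Between [x < y], the slope is controlled by the chord from [x] to [b] and by the one from [a] to
    [y]. Both have length at least [c], and [h] varies by at most [C] along them. *)
Lemma convex_lipschitz h a b c (C : R) : 0 < c -> convex_on h a b ->
  (forall x, a <= x <= b -> 0 <= h x <= C) ->
  forall x y, a + c <= x <= b - c -> a + c <= y <= b - c ->
    `|h x - h y| <= C / c * `|x - y|.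
Proof.
move=> c0 hconv hC.
wlog: / forall x y, a + c <= x <= b - c -> a + c <= y <= b - c -> x < y ->
    `|h x - h y| <= C / c * `|x - y|.
  move=> H; apply: H => x y xab yab xy.
  have [hx0 hx1] := andP (hC x ltac:(lra)).
  have [hy0 hy1] := andP (hC y ltac:(lra)).
  have [ha0 ha1] := andP (hC a ltac:(lra)).
  have [hb0 hb1] := andP (hC b ltac:(lra)).
  have slope d z : c <= d -> 0 <= z -> z <= C -> z * ((y - x) / d) <= C / c * (y - x).
    move=> cd z0 zC; rewrite mulrCA mulrC [leRHS]mulrAC -[leRHS]mulrA.
    have yx0 : 0 <= y - x by lra.
    rewrite [leRHS]mulrCA mulrC ler_wpM2l//.
    rewrite ler_pM ?invr_ge0 ?lef_pV2 ?posrE//; lra.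
  rewrite [`|x - y|]distrC [`|y - x|]ger0_norm ?subr_ge0 ?(ltW xy)//.
  rewrite ler_norml; apply/andP; split.
    have l01 : 0 <= (y - x) / (b - x) <= 1.
      by rewrite ler_pdivrMr ?divr_ge0; lra.
    have := hconv b x _ ltac:(lra) ltac:(lra) l01.
    have -> : (y - x) / (b - x) * b + (1 - (y - x) / (b - x)) * x = y.
      by field; rewrite gt_eqF; lra.
    have := slope (b - x) C ltac:(lra) ltac:(lra) (lexx _).
    set s := (y - x) / (b - x) in l01 *.
    nra.
  have l01 : 0 <= (y - x) / (y - a) <= 1.
    by rewrite ler_pdivrMr ?divr_ge0; lra.
  have := hconv a y _ ltac:(lra) ltac:(lra) l01.
  have -> : (y - x) / (y - a) * a + (1 - (y - x) / (y - a)) * y = x.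
    by field; rewrite gt_eqF; lra.
  have := slope (y - a) C ltac:(lra) ltac:(lra) (lexx _).
  set s := (y - x) / (y - a) in l01 *.
  nra.
move=> H x y xab yab; case: (ltgtP x y) => [xy|yx|->].
- exact: H.
- by rewrite distrC [`|x - y|]distrC; exact: H.
- by rewrite !subrr normr0 mulr0.
Qed.

Lemma lipschitz_within_continuous g a b (K : R) :
  (forall x y, a <= x <= b -> a <= y <= b -> `|g x - g y| <= K * `|x - y|) ->
  {within `[a, b], continuous g}.
Proof.
move=> gK; apply/subspace_continuousP => x xab.
have xab' : a <= x <= b by move: xab; rewrite /= in_itv.
apply/cvgrPdist_le => e e0.
have K1 : 0 < `|K| + 1 by rewrite ltr_wpDl.
have d0 : 0 < e / (`|K| + 1) by rewrite divr_gt0.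
near=> y.
have yab : a <= y <= b.
  have : `[a, b]%classic y by near: y; exact: withinT.
  by rewrite /= in_itv.
have xy : `|x - y| < e / (`|K| + 1).
  by near: y; apply: cvg_within; exact: (nbhsx_ballx x _ d0).
apply: le_trans (gK _ _ xab' yab) _.
move: xy; rewrite ltr_pdivlMr// mulrC => /ltW; apply: le_trans.
by apply: ler_wpM2r => //; rewrite (le_trans (ler_norm K))// lerDl.
Unshelve. all: by end_near. Qed.

End ConvexFunctions.

(** * The Hermite-Hadamard inequality and the averaged integrals *)

Section HermiteHadamard.
Context {R : realType}.
Implicit Types (g h : R -> R) (a b l x y : R).

Lemma Rintegral_reflect g a b : a < b -> {within `[a, b], continuous g} ->
  \int[lebesgue_measure]_(x in `[a, b]) g (a + b - x) =
  \int[lebesgue_measure]_(x in `[a, b]) g x.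
Proof.
move=> ab cg.
pose F x := a + b - x.
have DF : derive1 F = cst (-1).
  by apply/funext => z; rewrite derive1E deriveB// derive_cst derive_id sub0r.
have Fa : F a = b by rewrite /F; ring.
have Fb : F b = a by rewrite /F; ring.
have cF : continuous F.
  by move=> x; apply: cvgB; [exact: cvg_cst|exact: cvg_id].
rewrite /Rintegral; congr fine.
have := @integration_by_substitution_decreasing R F g a b (ltW ab).
rewrite Fa Fb => -> //.
- by apply: eq_integral => x _; rewrite !fctE DF /= opprK mulr1.
- by move=> x y _ _ xy; rewrite /F; lra.
- by rewrite DF => ? _; exact: cvg_cst.
- by rewrite DF; exact: is_cvg_cst.
- by rewrite DF; exact: is_cvg_cst.
- split => /=.
  + by move=> x _; exact: derivableB.
  + by apply: cvg_at_right_filter; exact: cF.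
  + by apply: cvg_at_left_filter; exact: cF.
Qed.

(** Reflection symmetrises the integrand: twice the integral is that of [g x + g (a + b - x)], and
    convexity places this sum pointwise between [2 * g ((a + b) / 2)] and [g a + g b]. *)
Lemma hermite_hadamard g a b : a < b -> {within `[a, b], continuous g} ->
  convex_on g a b ->
  g ((a + b) / 2) <=
    (b - a)^-1 * \int[lebesgue_measure]_(x in `[a, b]) g x <= (g a + g b) / 2.
Proof.
move=> ab cg gconv.
set I := \int[_]_(_ in _) _.
pose G x := g (a + b - x).
have cG : {within `[a, b], continuous G}.
  apply/subspace_continuousP => x xab.
  move/subspace_continuousP : cg => /(_ (a + b - x)).
  have xab' : `[a, b]%classic (a + b - x).
    by move: xab; rewrite /= !in_itv /=; lra.
  move=> /(_ xab') cg; apply: (cvg_trans _ cg) => P [] e /= e0 He.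
  exists e => //= y xy yab.
  apply: (He (a + b - y)) => /=.
    have xy' : `|x - y| < e by exact: xy.
    suff : `|(a + b - x) - (a + b - y)| < e by [].
    have -> : (a + b - x) - (a + b - y) = y - x by ring.
    by rewrite distrC.
  by move: yab; rewrite /= !in_itv /=; lra.
pose mu := @lebesgue_measure R.
have int f : {within `[a, b], continuous f} -> mu.-integrable `[a, b] (EFin \o f).
  by move=> cf; apply: continuous_compact_integrable => //; exact: segment_compact.
have cst_int c : \int[mu]_(x in `[a, b]) c = c * (b - a).
  by rewrite Rintegral_cst//= lebesgue_measure_itv/= lte_fin ab.
have ccst c : {within `[a, b], continuous (fun=> c : R)}.
  by apply: continuous_subspaceT => x; exact: cvg_cst.
have cgG : {within `[a, b], continuous (fun x => g x + G x)}.
  by move=> x; apply: cvgD; [exact: cg|exact: cG].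
have I2 : \int[mu]_(x in `[a, b]) (g x + G x) = 2 * I.
  rewrite RintegralD//; [|exact: int|exact: int].
  by rewrite Rintegral_reflect// -/I; ring.
have lo : 2 * g ((a + b) / 2) * (b - a) <= 2 * I.
  rewrite -I2 -cst_int; apply: le_Rintegral => //; [exact: int|exact: int|].
  move=> x; rewrite /= in_itv /= => xab.
  have := gconv x (a + b - x) (1 / 2) xab ltac:(lra) ltac:(lra).
  have -> : 1 / 2 * x + (1 - 1 / 2) * (a + b - x) = (a + b) / 2 by field.
  rewrite /G; lra.
have hi : 2 * I <= (g a + g b) * (b - a).
  rewrite -I2 -cst_int; apply: le_Rintegral => //; [exact: int|exact: int|].
  move=> x; rewrite /= in_itv /= => xab.
  have ab0 : b - a != 0 by rewrite subr_eq0 gt_eqF.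
  pose l := (b - x) / (b - a).
  have l01 : 0 <= l <= 1 by rewrite /l ler_pdivrMr ?divr_ge0; lra.
  have := gconv a b l ltac:(lra) ltac:(lra) l01.
  have -> : l * a + (1 - l) * b = x by rewrite /l; field.
  have := gconv b a l ltac:(lra) ltac:(lra) l01.
  have -> : l * b + (1 - l) * a = a + b - x by rewrite /l; field.
  rewrite /G; lra.
have ba0 : 0 < b - a by lra.
rewrite (mulrC (b - a)^-1) ler_pdivlMr// ler_pdivrMr//; lra.
Qed.

(** The Lipschitz bound is asked only along the filter, because the one-sided limits below approach
    an end of the interval on which [h] is controlled. *)
Lemma lipschitz_cvg (T : Type) (F : set_system T) (FF : ProperFilter F) h (K c : R) (u : T -> R) :
  (\forall t \near F, `|h c - h (u t)| <= K * `|c - u t|) ->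
  u t @[t --> F] --> c -> h (u t) @[t --> F] --> h c.
Proof.
move=> hK uc; apply/cvgrPdist_le => e e0.
have K1 : 0 < `|K| + 1 by rewrite ltr_wpDl.
have d0 : 0 < e / (`|K| + 1) by rewrite divr_gt0.
near=> t.
apply: (@le_trans _ _ (K * `|c - u t|)); first by near: t.
have : `|c - u t| < e / (`|K| + 1).
  by near: t; move/cvgrPdist_lt : uc; exact.
rewrite ltr_pdivlMr// mulrC => /ltW; apply: le_trans; apply: ler_wpM2r => //.
by rewrite (le_trans (ler_norm K))// lerDl.
Unshelve. all: by end_near. Qed.

Section means.
Variables (h : R -> R) (K : R).
Hypothesis hconv : convex_on h (1 / 2) (3 / 2).
Hypothesis hlip : forall x y, 1 / 2 <= x <= 3 / 2 -> 1 / 2 <= y <= 3 / 2 ->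
  `|h x - h y| <= K * `|x - y|.

Let hh x y : 1 / 2 <= x -> x < y -> y <= 3 / 2 ->
  h ((x + y) / 2) <= (y - x)^-1 *
    \int[lebesgue_measure]_(nu in `[x - 1 / 2, y - 1 / 2]) h (nu + 1 / 2)
    <= (h x + h y) / 2.
Proof.
move=> x1 xy y3.
pose g nu := h (nu + 1 / 2).
have := @hermite_hadamard g (x - 1 / 2) (y - 1 / 2).
rewrite /g !subrK.
have -> : (x - 1 / 2 + (y - 1 / 2)) / 2 + 1 / 2 = (x + y) / 2 by field.
have -> : y - 1 / 2 - (x - 1 / 2) = y - x by ring.
apply; first by lra.
- apply: (@lipschitz_within_continuous _ _ _ _ K) => u v hu hv.
  have -> : u - v = (u + 1 / 2) - (v + 1 / 2) by ring.
  apply: hlip; lra.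
- move=> u v l hu hv hl.
  have -> : l * u + (1 - l) * v + 1 / 2 =
    l * (u + 1 / 2) + (1 - l) * (v + 1 / 2) by field.
  apply: hconv => //; lra.
Qed.

Lemma mean_left_quot_bounds r : 1 / 2 < r <= 3 / 2 ->
  h ((2 * r + 1) / 4) <= mean_left_quot h r <= (h (1 / 2) + h r) / 2.
Proof.
move=> /andP[r1 r2]; have := hh (lexx _) r1 r2.
rewrite subrr /mean_left_quot.
by have -> : (1 / 2 + r) / 2 = (2 * r + 1) / 4 by field.
Qed.

Lemma mean_right_quot_bounds r : 1 / 2 <= r < 3 / 2 ->
  h ((2 * r + 3) / 4) <= mean_right_quot h r <= (h r + h (3 / 2)) / 2.
Proof.
move=> /andP[r1 r2]; have := hh r1 r2 (lexx _).
rewrite /mean_right_quot.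
have -> : (r + 3 / 2) / 2 = (2 * r + 3) / 4 by field.
by have -> : 3 / 2 - 1 / 2 = 1 :> R by field.
Qed.

(** At [r = 1 / 2] the mean is a limit; both Hermite-Hadamard bounds tend to [h (1 / 2)] and squeeze
    it to that value. *)
Lemma mean_left_bounds r : 1 / 2 <= r <= 3 / 2 ->
  h ((2 * r + 1) / 4) <= mean_left h r <= (h (1 / 2) + h r) / 2.
Proof.
move=> /andP[r1 r2]; rewrite /mean_left; case: eqVneq => [->|rn]; last first.
  by apply: mean_left_quot_bounds; rewrite lt_neqAle eq_sym rn r1.
have -> : (2 * (1 / 2) + 1) / 4 = 1 / 2 :> R by field.
suff -> : lim (mean_left_quot h u @[u --> (1 / 2)^'+]) = h (1 / 2) by lra.
have c12 : h (1 / 2) = (h (1 / 2) + h (1 / 2)) / 2 by field.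
have near_dom : \forall u \near (1 / 2 : R)^'+, 1 / 2 < u <= 3 / 2.
  near=> u; apply/andP; split; first by near: u; exact: nbhs_right_gt.
  by near: u; apply: nbhs_right_le; lra.
apply: cvg_lim => //; apply: (@squeeze_cvgr _ _ _ _ (fun u => h ((2 * u + 1) / 4))
  (fun u => (h (1 / 2) + h u) / 2)).
- by near=> u; apply: mean_left_quot_bounds; near: u.
- apply: (@lipschitz_cvg _ _ _ _ K).
    near=> u; apply: hlip; first lra.
    have : 1 / 2 < u <= 3 / 2 by near: u.
    lra.
  have {2}-> : 1 / 2 = (2 * (1 / 2) + 1) / 4 :> R by field.
  apply: cvg_at_right_filter; apply: cvgMr_tmp; apply: cvgD; last exact: cvg_cst.
  by apply: cvgMl_tmp; exact: cvg_id.
- rewrite {2}c12; apply: cvgMr_tmp; apply: cvgD; first exact: cvg_cst.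
  apply: (@lipschitz_cvg _ _ _ _ K).
    near=> u; apply: hlip; first lra.
    have : 1 / 2 < u <= 3 / 2 by near: u.
    lra.
  by apply: cvg_at_right_filter; exact: cvg_id.
Unshelve. all: by end_near. Qed.

Lemma mean_right_bounds r : 1 / 2 <= r <= 3 / 2 ->
  h ((2 * r + 3) / 4) <= mean_right h r <= (h r + h (3 / 2)) / 2.
Proof.
move=> /andP[r1 r2]; rewrite /mean_right; case: eqVneq => [->|rn]; last first.
  by apply: mean_right_quot_bounds; rewrite lt_neqAle rn r1.
have -> : (2 * (3 / 2) + 3) / 4 = 3 / 2 :> R by field.
suff -> : lim (mean_right_quot h u @[u --> (3 / 2)^'-]) = h (3 / 2) by lra.
have c12 : h (3 / 2) = (h (3 / 2) + h (3 / 2)) / 2 by field.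
have near_dom : \forall u \near (3 / 2 : R)^'-, 1 / 2 <= u < 3 / 2.
  near=> u; apply/andP; split; last by near: u; exact: nbhs_left_lt.
  by near: u; apply: nbhs_left_ge; lra.
apply: cvg_lim => //; apply: (@squeeze_cvgr _ _ _ _ (fun u => h ((2 * u + 3) / 4))
  (fun u => (h u + h (3 / 2)) / 2)).
- by near=> u; apply: mean_right_quot_bounds; near: u.
- apply: (@lipschitz_cvg _ _ _ _ K).
    near=> u; apply: hlip; first lra.
    have : 1 / 2 <= u < 3 / 2 by near: u.
    lra.
  have {2}-> : 3 / 2 = (2 * (3 / 2) + 3) / 4 :> R by field.
  apply: cvg_at_left_filter; apply: cvgMr_tmp; apply: cvgD; last exact: cvg_cst.
  by apply: cvgMl_tmp; exact: cvg_id.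
- rewrite {2}c12; apply: cvgMr_tmp; apply: cvgD; last exact: cvg_cst.
  apply: (@lipschitz_cvg _ _ _ _ K).
    near=> u; apply: hlip; first lra.
    have : 1 / 2 <= u < 3 / 2 by near: u.
    lra.
  by apply: cvg_at_left_filter; exact: cvg_id.
Unshelve. all: by end_near. Qed.

End means.

End HermiteHadamard.

(** * Factorization of [(1 + X)^n + (1 - X)^n] *)

Section EulerPolynomial.
Context {R : realType}.
Implicit Types (x y : R) (z : R[i]).

(** From [1 + x <= exp x] at [x] and at [-x]: the latter gives [exp x <= 1 / (1 - x)], so the
    remainder is at most [x^2 / (1 - x)]. *)
Lemma expR_approx2 x : `|x| <= 1 / 2 -> `|expR x - 1 - x| <= 2 * x ^+ 2.
Proof.
rewrite ler_norml => /andP[x1 x2].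
have lo : 1 + x <= expR x by exact: expR_ge1Dx.
have := expR_ge1Dx (- x); rewrite expRN => hi.
have e0 := expR_gt0 x.
have hi' : expR x * (1 - x) <= 1.
  by move: hi; rewrite -[leRHS]mul1r ler_pdivlMr// mulrC.
rewrite ger0_norm; last by lra.
have : (expR x - 1 - x - 2 * x ^+ 2) * (1 - x) <= 0 by nra.
rewrite pmulr_lle0; lra.
Qed.

Lemma expR_approx1 x : `|x| <= 1 / 2 -> `|expR x - 1| <= 2 * `|x|.
Proof.
move=> x1; have := expR_approx2 x1.
have := ler_normD (expR x - 1 - x) x; rewrite subrK.
rewrite -[x ^+ 2]real_normK ?num_real//.
have := normr_ge0 x; nra.
Qed.

(* At a root, [1 + z] and [1 - z] have the same modulus. *)
Lemma sum_pow_root_imaginary n z : (0 < n)%N ->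
  (1 + z) ^+ n + (1 - z) ^+ n = 0 -> complex.Re z = 0.
Proof.
move=> n0 /eqP; rewrite addr_eq0 => /eqP /(congr1 Num.norm).
rewrite normrN !normrX => /eqP; rewrite eqrXn2// => /eqP e.
have : `|1 + z| ^+ 2 = `|1 - z| ^+ 2 by rewrite e.
rewrite -!add_Re2_Im2; case: z {e} => a b /= /complexI.
rewrite !add0r => e; nra.
Qed.

Lemma sum_pow_factor n : (0 < n)%N -> exists s : seq R,
  (1 + 'X) ^+ n + (1 - 'X) ^+ n =
  2%:P * \prod_(l <- s) (1 + (Complex 0 l) *: 'X) :> {poly R[i]}.
Proof.
move=> n0; set p := _ + _.
have p0 : p.[0] = 2.
  by rewrite /p !hornerE /= subr0 expr1n -natr1.
have [r pr] := closed_field_poly_normal p.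
have rootim z : z \in r -> z != 0 /\ complex.Re z = 0.
  move=> zr; have pz : p.[z] = 0.
    apply/eqP; rewrite -/(root p z) pr rootZ ?root_prod_XsubC//.
    by apply/eqP => l0; move: p0; rewrite pr l0 scale0r horner0 => /esym/eqP; rewrite pnatr_eq0.
  split; last by apply: sum_pow_root_imaginary n0 _; rewrite -pz /p !hornerE.
  by apply: contra_eqN pz => /eqP->; rewrite p0 pnatr_eq0.
exists [seq (complex.Im z)^-1 | z <- r]; rewrite big_map.
have -> : p = (lead_coef p * \prod_(z <- r) (- z)) *:
    \prod_(z <- r) (1 + Complex 0 (complex.Im z)^-1 *: 'X).
  rewrite {1}pr -scalerA; congr (_ *: _); rewrite -scaler_prod.
  apply: eq_big_seq => z /rootim[z0 zre].
  rewrite scalerDr alg_polyC polyCN addrC scalerA.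
  have -> : - z * Complex 0 (complex.Im z)^-1 = 1.
    case: z z0 zre => a b /= + a0; rewrite a0 eq_complex /= eqxx /= => b0.
    by apply/eqP; rewrite eq_complex /=; simpc; rewrite mulfV ?eqxx//.
  by rewrite scale1r.
rewrite mul_polyC; congr (_ *: _).
rewrite -p0 {2}pr hornerZ horner_prod; congr (_ * _).
by apply: eq_bigr => z _; rewrite !hornerE.
Qed.

End EulerPolynomial.

(** * Polynomials in a linear map *)

Section PolynomialEvaluation.
Context {K : comNzRingType} {V : lmodType K}.
Implicit Types (D : V -> V) (p q : {poly K}) (v : V).

(** The space [V] is left general: it is [H] when polynomials in an operator are studied, and the
    space of maps [H -> H] when [D] is a derivation. *)
Definition pev D p v : V := \sum_(i < size p) p`_i *: iter i D v.

Lemma pev_widen D p v n : (size p <= n)%N ->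
  pev D p v = \sum_(i < n) p`_i *: iter i D v.
Proof.
move=> pn; rewrite /pev (big_ord_widen n (fun i => p`_i *: iter i D v))// big_mkcond.
apply: eq_bigr => i _; case: ltnP => // ip.
by rewrite nth_default// scale0r.
Qed.

Lemma pevD D p q v : pev D (p + q) v = pev D p v + pev D q v.
Proof.
pose n := maxn (size p) (size q).
rewrite (@pev_widen _ (p + q) _ n) ?size_polyD//.
rewrite (@pev_widen _ p _ n) ?leq_maxl// (@pev_widen _ q _ n) ?leq_maxr//.
by rewrite -big_split; apply: eq_bigr => i _; rewrite coefD scalerDl.
Qed.

Lemma pevZ D c p v : pev D (c *: p) v = c *: pev D p v.
Proof.
rewrite (@pev_widen _ _ _ (size p)) ?size_scale_leq// /pev scaler_sumr.
by apply: eq_bigr => i _; rewrite coefZ scalerA.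
Qed.

Lemma pevC D c v : pev D c%:P v = c *: v.
Proof.
by rewrite (@pev_widen _ _ _ 1%N) ?size_polyC_leq1// big_ord1 coefC.
Qed.

Lemma pev1 D v : pev D 1 v = v.
Proof. by rewrite pevC scale1r. Qed.

Lemma pevMX D p v : pev D (p * 'X) v = pev D p (D v).
Proof.
rewrite (@pev_widen _ _ _ (size p).+1); last first.
  by rewrite (leq_trans (size_polyMleq _ _))// size_polyX addn2.
rewrite big_ord_recl coefMX eqxx scale0r add0r.
by apply: eq_bigr => i _; rewrite coefMX /= -iterS iterSr.
Qed.

Lemma pevX D v : pev D 'X v = D v.
Proof. by rewrite -['X]mul1r pevMX pev1. Qed.

Section linear.
Variable D : V -> V.
Hypothesis linD : linear D.

Lemma linear_map0 : D 0 = 0.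
Proof. by have := linD (-1) 0 0; rewrite !scaleN1r oppr0 addr0 addNr. Qed.

Lemma linear_mapD u v : D (u + v) = D u + D v.
Proof. by have := linD 1 u v; rewrite !scale1r. Qed.

Lemma linear_mapZ c v : D (c *: v) = c *: D v.
Proof. by have := linD c v 0; rewrite linear_map0 !addr0. Qed.

Lemma linear_mapN v : D (- v) = - D v.
Proof. by rewrite -scaleN1r linear_mapZ scaleN1r. Qed.

Lemma linear_mapB u v : D (u - v) = D u - D v.
Proof. by rewrite linear_mapD linear_mapN. Qed.

Lemma linear_map_sum n (F : 'I_n -> V) : D (\sum_i F i) = \sum_i D (F i).
Proof. by apply: big_morph; [exact: linear_mapD|exact: linear_map0]. Qed.

Lemma pev_comm p v : D (pev D p v) = pev D p (D v).
Proof.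
rewrite /pev linear_map_sum; apply: eq_bigr => i _.
by rewrite linear_mapZ -iterS iterSr.
Qed.

Lemma pevM p q v : pev D (p * q) v = pev D p (pev D q v).
Proof.
elim/poly_ind: p v => [|p c IH] v; first by rewrite mul0r /pev size_poly0 !big_ord0.
rewrite mulrDl !pevD mul_polyC pevZ pevC -mulrA -commr_polyX mulrA !pevMX IH.
by rewrite pev_comm.
Qed.

End linear.
End PolynomialEvaluation.

(** * Bounded operators on a Hilbert space *)

Section Hilbert.
Context {R : realType} {H : hilbertType R}.
Implicit Types (x y : H) (S T A : H -> H) (z : R[i]) (c e M : R).

(** A real-valued norm, so that the estimates can be carried out in [R] instead of [R[i]]. *)
Definition nrm x : R := complex.Re `|x|.

Lemma nrmE x : `|x| = (nrm x)%:C.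
Proof.
by rewrite /nrm; have /ger0_Im := normr_ge0 x; case: `|x| => a b /= ->.
Qed.

Lemma nrm_ge0 x : 0 <= nrm x.
Proof. by rewrite -ler0c -nrmE. Qed.

Lemma nrm0 : nrm 0 = 0.
Proof. by rewrite /nrm normr0. Qed.

Lemma nrm_eq0 x : nrm x = 0 -> x = 0.
Proof. by move=> x0; apply/normr0_eq0; rewrite nrmE x0. Qed.

Lemma nrm_small x : (forall e, 0 < e -> nrm x <= e) -> x = 0.
Proof.
move=> h; apply: nrm_eq0; apply/le_anti; rewrite nrm_ge0 andbT.
by apply/ler_addgt0Pr => e e0; rewrite add0r h.
Qed.

Lemma nrmD x y : nrm (x + y) <= nrm x + nrm y.
Proof. by rewrite -lecR raddfD /= -!nrmE ler_normD. Qed.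

Lemma nrmZ z x : nrm (z *: x) = complex.Re `|z| * nrm x.
Proof.
rewrite /nrm normrZ; have /ger0_Im := normr_ge0 z.
case: `|z| => a b /= ->; case: `|x| => a' b' /=; by rewrite mul0r subr0.
Qed.

Lemma Re_norm_real c : complex.Re `|c%:C| = `|c|.
Proof. by rewrite normc_def /= expr0n addr0 sqrtr_sqr. Qed.

Lemma nrmZr c x : nrm (c%:C *: x) = `|c| * nrm x.
Proof. by rewrite nrmZ Re_norm_real. Qed.

Lemma nrmN x : nrm (- x) = nrm x.
Proof. by rewrite /nrm normrN. Qed.

Lemma nrmB x y : nrm (x - y) = nrm (y - x).
Proof. by rewrite /nrm distrC. Qed.

Lemma inner_nrm x : inner x x = ((nrm x) ^+ 2)%:C.
Proof. by rewrite -inner_normE nrmE rmorphXn. Qed.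

Lemma innerC x y : inner x y = (inner y x)^*%C.
Proof. by rewrite hermC /= expr0 mul1r. Qed.

Lemma innerZl z x y : inner (z *: x) y = z * inner x y.
Proof. by rewrite linearZl_LR. Qed.

Lemma innerZr z x y : inner x (z *: y) = z^*%C * inner x y.
Proof. by rewrite linearZr_LR. Qed.

Lemma inner_cauchy_schwarz x y : `|inner x y| <= (nrm x * nrm y)%:C.
Proof.
have [y0|yN0] := eqVneq (nrm y) 0.
  by rewrite (nrm_eq0 y0) linear0r normr0 nrm0 mulr0.
have q0 : 0 < nrm y by rewrite lt_neqAle eq_sym yN0 nrm_ge0.
set s := inner x y; set q := nrm y in q0 *; set p := nrm x.
have : inner (x - (s / (q ^+ 2)%:C) *: y) (x - (s / (q ^+ 2)%:C) *: y) =
    (p ^+ 2)%:C - s * s^*%C / (q ^+ 2)%:C.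
  rewrite linearBl /= !linearBr /= !innerZl !innerZr (innerC y x) -/s !inner_nrm.
  rewrite -/p -/q.
  have -> : (s / (q ^+ 2)%:C)^*%C = s^*%C / (q ^+ 2)%:C.
    rewrite -fmorphV /=; move: (_^-1) => k; case: (s) => a b.
    by apply/eqP; rewrite eq_complex /= !mulr0 !subr0 !add0r mulNr !eqxx.
  have : (q ^+ 2)%:C != 0 by rewrite eq_complex /= eqxx andbT expf_neq0// gt_eqF.
  by move: (q ^+ 2)%:C (p ^+ 2)%:C s^*%C => a b c a0; field.
rewrite inner_nrm -sqr_normc => h.
have : (0 : R[i]) <= (p ^+ 2)%:C - `|s| ^+ 2 / (q ^+ 2)%:C.
  by rewrite -h ler0c sqr_ge0.
rewrite subr_ge0 ler_pdivrMr ?ltcR ?exprn_gt0// -rmorphM -exprMn rmorphXn.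
by rewrite ler_pXn2r ?nnegrE// ler0c mulr_ge0 ?nrm_ge0// ltW.
Qed.

Lemma op_addE S T x : (S + T) x = S x + T x. Proof. by []. Qed.
Lemma op_oppE T x : (- T) x = - T x. Proof. by []. Qed.
Lemma op_scaleE z T x : (z *: T) x = z *: T x. Proof. by []. Qed.
Lemma op_zeroE x : (0 : H -> H) x = 0. Proof. by []. Qed.
Definition opE := (op_addE, op_oppE, op_scaleE, op_zeroE).

(** Explicit bounds compose and add directly, whereas the supremum in [opnorm] is meaningful only
    once boundedness is known. *)
Definition bnd T M := forall x, nrm (T x) <= M * nrm x.

Lemma bndW T M M' : M <= M' -> bnd T M -> bnd T M'.
Proof. by move=> MM' TM x; rewrite (le_trans (TM x))// ler_wpM2r ?nrm_ge0. Qed.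

Lemma bounded_opP T : bounded_op T <->
  linear T /\ exists2 M : R, 0 <= M & bnd T M.
Proof.
split=> -[lT].
  move=> [M hM]; split=> //; exists `|M| => //.
  apply: (@bndW _ M); first exact: ler_norm.
  by move=> x; have := hM x; rewrite !nrmE -rmorphM lecR.
move=> [M _ hM]; split=> //; exists M => x; by rewrite !nrmE -rmorphM lecR.
Qed.

Lemma bnd_comp S T M M' : 0 <= M -> bnd S M -> bnd T M' -> bnd (S \o T) (M * M').
Proof.
by move=> M0 SM TM x; rewrite (le_trans (SM _))// -mulrA ler_wpM2l.
Qed.

Lemma bndD S T M M' : bnd S M -> bnd T M' -> bnd (S + T) (M + M').
Proof.
by move=> SM TM x; rewrite (le_trans (nrmD _ _))// mulrDl lerD.
Qed.

Lemma bndN T M : bnd T M -> bnd (- T) M.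
Proof. by move=> TM x; rewrite [(- T) x]/(- T x) nrmN. Qed.

Lemma bndB S T M M' : bnd S M -> bnd T M' -> bnd (S - T) (M + M').
Proof. by move=> SM /bndN; exact: bndD. Qed.

Lemma bnd_sym S T M : bnd (S - T) M -> bnd (T - S) M.
Proof. by move=> /bndN; rewrite opprB. Qed.

Lemma bnd_tri S T U M M' : bnd (S - T) M -> bnd (T - U) M' -> bnd (S - U) (M + M').
Proof. by move=> h h'; have := bndD h h'; rewrite addrA subrK. Qed.

Lemma bndZ z T M : bnd T M -> bnd (z *: T) (complex.Re `|z| * M).
Proof.
move=> TM x; rewrite [(z *: T) x]/(z *: T x) nrmZ -mulrA ler_wpM2l//.
by rewrite -ler0c RRe_real ?normr_real.
Qed.

Lemma bndZr c T M : bnd T M -> bnd (c%:C *: T) (`|c| * M).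
Proof. by move/(bndZ c%:C); rewrite Re_norm_real. Qed.

Lemma bnd_id : bnd id 1.
Proof. by move=> x; rewrite mul1r. Qed.

Lemma bnd_small T : (forall e, 0 < e -> bnd T e) -> T = 0.
Proof.
move=> h; apply/funext => x; apply: nrm_small => e e0.
have n1 : 0 < nrm x + 1 by rewrite ltr_wpDl ?nrm_ge0.
apply: le_trans (h (e / (nrm x + 1)) _ x) _; first by rewrite divr_gt0.
by rewrite mulrAC ler_pdivrMr// ler_pM2l// lerDl.
Qed.

Lemma bounded_id : bounded_op (id : H -> H).
Proof.
by apply/bounded_opP; split=> [c u v|] //; exists 1 => //; exact: bnd_id.
Qed.

Lemma bounded_comp S T : bounded_op S -> bounded_op T -> bounded_op (S \o T).
Proof.
move=> /bounded_opP[lS [M M0 SM]] /bounded_opP[lT [M' M'0 TM]].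
apply/bounded_opP; split; first by move=> c u v /=; rewrite lT lS.
by exists (M * M'); [rewrite mulr_ge0|exact: bnd_comp].
Qed.

Lemma bounded_lin z S T : bounded_op S -> bounded_op T -> bounded_op (z *: S + T).
Proof.
move=> /bounded_opP[lS [M M0 SM]] /bounded_opP[lT [M' M'0 TM]].
apply/bounded_opP; split.
  move=> c u v; rewrite !opE lT lS.
  by rewrite !scalerDr !scalerA (mulrC z c) -!addrA; congr (_ + _); rewrite addrCA.
have zM := bndZ z SM; exists (complex.Re `|z| * M + M'); last exact: bndD.
by rewrite addr_ge0// mulr_ge0// -ler0c RRe_real ?normr_real.
Qed.

Lemma bounded0 : bounded_op (0 : H -> H).
Proof.
apply/bounded_opP; split; first by move=> c u v; rewrite !opE scaler0 addr0.
by exists 0 => // x; rewrite mul0r op_zeroE nrm0.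
Qed.

Lemma boundedD S T : bounded_op S -> bounded_op T -> bounded_op (S + T).
Proof. by move=> bS bT; have := bounded_lin 1 bS bT; rewrite scale1r. Qed.

Lemma boundedZ z S : bounded_op S -> bounded_op (z *: S).
Proof. by move=> bS; have := bounded_lin z bS bounded0; rewrite addr0. Qed.

Lemma boundedB S T : bounded_op S -> bounded_op T -> bounded_op (S - T).
Proof. by move=> bS bT; rewrite addrC -scaleN1r; exact: bounded_lin. Qed.

Lemma opnorm_le T M : 0 <= M -> bnd T M -> opnorm T <= M.
Proof.
move=> M0 TM; apply: ge_sup.
  by exists (nrm (T 0)), 0 => //=; rewrite normr0.
move=> _ [x /= x1 <-]; apply: le_trans (TM x) _.
by rewrite ler_piMr//; move: x1; rewrite nrmE lecR.
Qed.

Lemma opnorm_ge T M x : bnd T M -> nrm x <= 1 -> nrm (T x) <= opnorm T.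
Proof.
move=> TM x1; apply: ub_le_sup; last by exists x => //=; rewrite nrmE lecR.
exists `|M| => _ [y /= y1 <-]; apply: le_trans (TM y) _.
apply: (@le_trans _ _ (`|M| * nrm y)); first by rewrite ler_wpM2r ?nrm_ge0 ?ler_norm.
by rewrite ler_piMr//; move: y1; rewrite nrmE lecR.
Qed.

Lemma opnorm_ge0 T : bounded_op T -> 0 <= opnorm T.
Proof.
move=> /bounded_opP[lT [M M0 TM]].
by apply: le_trans (nrm_ge0 (T 0)) (opnorm_ge TM _); rewrite nrm0.
Qed.

Lemma bnd_opnorm T : bounded_op T -> bnd T (opnorm T).
Proof.
move=> bT; have [lT [M M0 TM]] := (bounded_opP T).1 bT.
move=> x; have [x0|xN0] := eqVneq (nrm x) 0.
  by rewrite (nrm_eq0 x0) linear_map0// nrm0 mulr0.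
have x0 : 0 < nrm x by rewrite lt_neqAle eq_sym xN0 nrm_ge0.
rewrite -ler_pdivrMr// mulrC -[(nrm x)^-1]ger0_norm ?invr_ge0 ?nrm_ge0//.
rewrite -nrmZr -linear_mapZ//; apply: (opnorm_ge TM).
by rewrite nrmZr ger0_norm ?invr_ge0 ?nrm_ge0// mulVf.
Qed.

(** Completeness of [H] gives pointwise limits. The Cauchy bounds are uniform in the vector, so the
    convergence is in operator norm, and linearity and boundedness pass to the limit. *)
Lemma cauchy_op (T_ : nat -> H -> H) : (forall n, bounded_op (T_ n)) ->
  (forall e, 0 < e -> exists n0, forall m n, (n0 <= m)%N -> (n0 <= n)%N ->
    bnd (T_ m - T_ n) e) ->
  exists2 T, bounded_op T & forall e, 0 < e -> exists n0, forall n, (n0 <= n)%N ->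
    bnd (T_ n - T) e.
Proof.
move=> bT cT.
have cvgx x : exists y, forall e, 0 < e -> exists n0, forall n, (n0 <= n)%N ->
    nrm (T_ n x - y) < e.
  have : cvg ((fun n => T_ n x) @ \oo).
    apply/cauchy_cvgP/cauchy_exP => e e0.
    have [e' e'0 ee'] : exists2 e' : R, 0 < e' & e = e'%:C.
      by exists (complex.Re e); move: e0; rewrite ltcE /= => /andP[/eqP]; case: e => a b //= ->.
    have n1 : 0 < nrm x + 1 by rewrite ltr_wpDl ?nrm_ge0.
    have [n0 hn] := cT (e' / (nrm x + 1)) (divr_gt0 e'0 n1).
    exists (T_ n0 x), n0 => // n /= nn.
    suff : `|T_ n0 x - T_ n x| < e by rewrite -ball_normE.
    rewrite nrmE ee' ltcR.
    apply: le_lt_trans (hn _ _ (leqnn _) nn x) _.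
    by rewrite mulrAC ltr_pdivrMr// ltr_pM2l// ltrDl.
  move=> /cvg_ex[y hy]; exists y => e e0.
  have ec : 0 < e%:C by rewrite ltcR.
  move/cvgrPdist_lt : hy => /(_ _ ec)[n0 _ hn]; exists n0 => n nn.
  by have := hn n nn; rewrite /= nrmE ltcR nrmB.
have [T hT] := choice cvgx.
have TT e : 0 < e -> exists n0, forall n, (n0 <= n)%N -> bnd (T_ n - T) e.
  move=> e0; have [n0 hn] := cT e e0; exists n0 => n nn x.
  apply/ler_addgt0Pr => d d0; have [n1 hn1] := hT x d d0.
  pose m := maxn n0 n1.
  have := hn n m nn (leq_maxl _ _) x; have := hn1 m (leq_maxr _ _).
  rewrite !opE; have := nrmD (T_ n x - T_ m x) (T_ m x - T x).
  by rewrite addrA subrK; lra.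
exists T => //; have [n0 hn0] := TT 1 ltr01.
have [lT0 [M M0 hM]] := (bounded_opP _).1 (bT n0).
apply/bounded_opP; split; last first.
  exists (M + 1); first by rewrite addr_ge0.
  have -> : T = T_ n0 - (T_ n0 - T) by rewrite opprB addrC subrK.
  by apply: bndB => //; exact: hn0.
move=> c u v; apply/eqP; rewrite -subr_eq0; apply/eqP/nrm_small => e e0.
set K := nrm (c *: u + v) + complex.Re `|c| * nrm u + nrm v + 1.
have c0 : 0 <= complex.Re `|c| by rewrite -ler0c RRe_real ?normr_real.
have K0 : 0 < K by rewrite ltr_wpDl// !addr_ge0 ?mulr_ge0 ?nrm_ge0.
have [n hn] := TT (e / K) (divr_gt0 e0 K0).
have {}hn := hn n (leqnn _).
have [lTn _] := (bounded_opP _).1 (bT n).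
have -> : T (c *: u + v) - (c *: T u + T v) =
    - (T_ n - T) (c *: u + v) + (c *: (T_ n - T) u + (T_ n - T) v).
  rewrite !opE lTn opprB scalerBr.
  have -> : c *: T_ n u - c *: T u + (T_ n v - T v) =
      (c *: T_ n u + T_ n v) - (c *: T u + T v) by rewrite addrACA opprD.
  by rewrite addrA subrK.
apply: le_trans (nrmD _ _) _; rewrite nrmN.
apply: le_trans (lerD (hn _) (nrmD _ _)) _; rewrite nrmZ.
apply: le_trans (lerD (lexx _) (lerD (ler_wpM2l c0 (hn u)) (hn v))) _.
rewrite mulrCA -!mulrDr mulrAC ler_pdivrMr// ler_wpM2l ?ltW//.
by rewrite /K addrA ltrDl.
Qed.

End Hilbert.

(** * Spectrum and functional calculus of a positive operator *)

Section Spectrum.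
Context {R : realType} {H : hilbertType R}.
Implicit Types (x y : H) (S T A : H -> H) (z : R[i]) (c M : R) (p q : {poly R}).

Lemma not_spectrum_bounded_below A z : ~ spectrum A z ->
  exists2 K, 0 <= K & forall x, nrm x <= K * nrm (A x - z *: x).
Proof.
move=> /contrapT[T [/bounded_opP[_ [M M0 TM]] TA _]]; exists M => // x.
by have := TM ((A - z *: id) x); have := congr1 (@^~ x) TA => /= ->.
Qed.

Lemma pev_bounded_below A (s : seq R[i]) : linear A ->
  (forall z, z \in s -> ~ spectrum A z) ->
  exists2 K, 0 <= K & forall x, nrm x <= K * nrm (pev A (\prod_(z <- s) ('X - z%:P)) x).
Proof.
move=> lA; elim: s => [_|z s IH hs].
  by exists 1 => // x; rewrite big_nil pev1 mul1r.
have [|K K0 hK] := IH; first by move=> w ws; apply: hs; rewrite inE ws orbT.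
have [|L L0 hL] := @not_spectrum_bounded_below A z; first by apply: hs; rewrite inE eqxx.
exists (K * L); first exact: mulr_ge0.
move=> x; apply: le_trans (hK x) _; rewrite -mulrA ler_wpM2l//.
apply: le_trans (hL _) _; rewrite big_cons pevM// pevD pevX -polyCN pevC scaleNr.
exact: lexx.
Qed.

(** Half of the spectral mapping theorem: if no root of [q] were in the spectrum, every factor
    [A - z] would be bounded below, hence so would [q(A)]. *)
Lemma spectrum_root A (q : {poly R[i]}) : linear A -> q != 0 ->
  (forall K, 0 <= K -> exists x, K * nrm (pev A q x) < nrm x) ->
  exists2 z, spectrum A z & root q z.
Proof.
move=> lA q0 hq; have [s qs] := closed_field_poly_normal q.
have l0 : lead_coef q != 0 by rewrite lead_coef_eq0.
apply: contrapT => hn.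
have [|K K0 hK] := @pev_bounded_below A s lA.
  move=> z zs sz; apply: hn; exists z => //.
  by rewrite qs rootZ// root_prod_XsubC.
set l := lead_coef q in qs l0.
have nl : 0 < complex.Re `|l|.
  by rewrite -ltcR RRe_real ?normr_real// normr_gt0.
have [] := hq (K / complex.Re `|l|); first by rewrite divr_ge0// ltW.
move=> x; rewrite {}qs pevZ nrmZ mulrA divfK ?gt_eqF//.
by rewrite ltNge hK.
Qed.

Lemma op_hornerE A p x : op_horner p A x = pev A (map_poly (real_complex R) p) x.
Proof.
rewrite /op_horner fct_sumE /pev size_map_poly.
by apply: eq_bigr => i _; rewrite op_scaleE coef_map.
Qed.

Lemma op_hornerD A p q : op_horner (p + q) A = op_horner p A + op_horner q A.
Proof. by apply/funext => x; rewrite op_addE !op_hornerE rmorphD pevD. Qed.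

Lemma op_hornerZ A c p : op_horner (c *: p) A = c%:C *: op_horner p A.
Proof. by apply/funext => x; rewrite op_scaleE !op_hornerE map_polyZ pevZ. Qed.

Lemma op_hornerB A p q : op_horner (p - q) A = op_horner p A - op_horner q A.
Proof.
rewrite op_hornerD -scaleN1r op_hornerZ; congr (_ + _).
by rewrite rmorphN1 scaleN1r.
Qed.

Lemma op_hornerM A p q : linear A ->
  op_horner (p * q) A = op_horner p A \o op_horner q A.
Proof. by move=> lA; apply/funext => x; rewrite /= !op_hornerE rmorphM pevM. Qed.

Lemma op_hornerC A c : op_horner c%:P A = c%:C *: (id : H -> H).
Proof. by apply/funext => x; rewrite op_scaleE op_hornerE map_polyC pevC. Qed.

Lemma op_hornerX A : op_horner 'X A = A.
Proof. by apply/funext => x; rewrite op_hornerE map_polyX pevX. Qed.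

Lemma iter_bounded A i : bounded_op A -> bounded_op (iter i A).
Proof.
move=> bA; elim: i => [|i IH]; first exact: bounded_id.
exact: (bounded_comp bA IH).
Qed.

Lemma op_horner_bounded A p : bounded_op A -> bounded_op (op_horner p A).
Proof.
move=> bA; rewrite /op_horner; elim/big_ind: _ => [|S T bS bT|i _].
- exact: bounded0.
- exact: boundedD.
- by apply: boundedZ; exact: iter_bounded.
Qed.

Lemma adjoint_lin c S T : adjoint_op S S -> adjoint_op T T ->
  adjoint_op (c%:C *: S + T) (c%:C *: S + T).
Proof.
move=> aS aT x y; rewrite !opE linearDl /= linearDr /= innerZl innerZr.
by rewrite conjc_real aS aT.
Qed.

Lemma op_horner_adjoint A p : adjoint_op A A ->
  adjoint_op (op_horner p A) (op_horner p A).
Proof.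
move=> aA; have a0 : adjoint_op (0 : H -> H) 0.
  by move=> x y; rewrite !op_zeroE linear0l linear0r.
rewrite /op_horner; elim/big_ind: _ => [//|S T aS aT|i _].
  by have := adjoint_lin 1 aS aT; rewrite rmorph1 scale1r.
have ai : adjoint_op (iter i A) (iter i A).
  elim: (nat_of_ord i) => [//|n IH] x y.
  by rewrite iterS aA IH -iterSr.
by have := adjoint_lin (p`_i) ai a0; rewrite addr0.
Qed.

(* Vectors almost attaining the norm [m] of [T] are almost killed by
   [T^2 - m^2]. *)
Lemma norm_attained_approx T : bounded_op T -> adjoint_op T T ->
  0 < opnorm T ->
  forall K, 0 <= K -> exists x,
    K * nrm (T (T x) - (opnorm T ^+ 2)%:C *: x) < nrm x.
Proof.
move=> bT aT m0 K K0; set m := opnorm T in m0 *.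
have [lT _] := (bounded_opP _).1 bT; have Tm := bnd_opnorm bT.
have key x : nrm (T (T x) - (m ^+ 2)%:C *: x) ^+ 2 <=
    2 * m ^+ 2 * (m ^+ 2 * nrm x ^+ 2 - nrm (T x) ^+ 2).
  have : (nrm (T (T x) - (m ^+ 2)%:C *: x) ^+ 2) =
      nrm (T (T x)) ^+ 2 - 2 * m ^+ 2 * nrm (T x) ^+ 2 + m ^+ 4 * nrm x ^+ 2.
    apply: (@complexI R); rewrite -inner_nrm.
    rewrite linearBl /= !linearBr /= !innerZl !innerZr conjc_real.
    rewrite (aT (T x) x) -(aT x (T x)) !inner_nrm.
    rewrite (_ : m ^+ 4 = m ^+ 2 * m ^+ 2); last by rewrite -exprD.
    move: (nrm (T (T x)) ^+ 2) (nrm (T x) ^+ 2) (nrm x ^+ 2) (m ^+ 2) => a b d e.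
    by apply/eqP; rewrite eq_complex; apply/andP; split; apply/eqP => /=; ring.
  move=> ->; have : nrm (T (T x)) ^+ 2 <= m ^+ 2 * nrm (T x) ^+ 2.
    by rewrite -exprMn ler_pXn2r ?nnegrE ?mulr_ge0 ?nrm_ge0 ?(ltW m0)//.
  have h2 : nrm (T x) ^+ 2 <= m ^+ 2 * nrm x ^+ 2.
    by rewrite -exprMn ler_pXn2r ?nnegrE ?mulr_ge0 ?nrm_ge0 ?(ltW m0)//.
  have := ler_wpM2l (sqr_ge0 m) h2.
  have -> : m ^+ 4 = m ^+ 2 * m ^+ 2 by rewrite -exprD.
  lra.
have m2 : 0 < m ^+ 2 by rewrite exprn_gt0.
pose k := K ^+ 2 * m ^+ 2 * m ^+ 2.
have k0 : 0 <= k by apply: mulr_ge0; [apply: mulr_ge0|]; exact: sqr_ge0.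
have k1 : 0 < k + 1 by rewrite ltr_wpDl.
(* A vector of the unit ball with [nrm (T x) ^+ 2 > m ^+ 2 - d] will do: by [key] the squared norm
   to be bounded is at most [2 * m ^+ 2 * d], which [K ^+ 2] raises to at most 1/4, while
   [d <= m ^+ 2 / 8] forces [nrm x ^+ 2 > 1 / 2]. *)
pose d := m ^+ 2 / (8 * (k + 1)).
have d0 : 0 < d by rewrite divr_gt0// mulr_gt0.
have dm : d <= m ^+ 2 / 8.
  by rewrite /d ler_pM2l// lef_pV2 ?posrE ?mulr_gt0// ler_pMr// lerDr.
have dK : K ^+ 2 * (2 * m ^+ 2 * d) <= 1 / 4.
  have -> : K ^+ 2 * (2 * m ^+ 2 * d) = 1 / 4 * (k / (k + 1)).
    rewrite /d -[X in _ = _ * (X / _)]/(K ^+ 2 * m ^+ 2 * m ^+ 2).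
    by field; rewrite gt_eqF.
  by rewrite ger_pMr// ler_pdivrMr// mul1r lerDl.
have md0 : 0 <= m ^+ 2 - d by lra.
have [x [x1 hx]] : exists x, nrm x <= 1 /\ m ^+ 2 - d < nrm (T x) ^+ 2.
  apply: contrapT => hn.
  have : m <= Num.sqrt (m ^+ 2 - d).
    rewrite /m; apply: ge_sup; first by exists (nrm (T 0)), 0 => //=; rewrite normr0.
    move=> _ [x /= x1 <-]; rewrite nrmE lecR in x1.
    rewrite -[complex.Re _]/(nrm (T x)) -(ger0_norm (nrm_ge0 _)) -sqrtr_sqr ler_sqrt//.
    by rewrite leNgt; apply/negP => h; apply: hn; exists x.
  rewrite leNgt => /negP; apply; rewrite -[ltRHS](ger0_norm (ltW m0)) -sqrtr_sqr.
  by rewrite ltr_sqrt//; lra.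
exists x.
have x2 : nrm x ^+ 2 <= 1 by rewrite expr_le1// nrm_ge0.
have kk : nrm (T (T x) - (m ^+ 2)%:C *: x) ^+ 2 <= 2 * m ^+ 2 * d.
  apply: le_trans (key x) _; rewrite ler_pM2l ?mulr_gt0//.
  have : m ^+ 2 * nrm x ^+ 2 <= m ^+ 2 by rewrite ler_piMr// ltW.
  lra.
have x2' : 1 / 2 < nrm x ^+ 2.
  have : nrm (T x) ^+ 2 <= m ^+ 2 * nrm x ^+ 2.
    by rewrite -exprMn ler_pXn2r ?nnegrE ?mulr_ge0 ?nrm_ge0 ?(ltW m0)//.
  move=> h; have : m ^+ 2 * (1 / 2) < m ^+ 2 * nrm x ^+ 2 by lra.
  by rewrite ltr_pM2l.
rewrite -(@ltr_pXn2r _ 2) ?nnegrE ?mulr_ge0 ?nrm_ge0//.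
rewrite exprMn; apply: (@le_lt_trans _ _ (K ^+ 2 * (2 * m ^+ 2 * d))).
  by rewrite ler_wpM2l// sqr_ge0.
lra.
Qed.

End Spectrum.

Section PositiveOperator.
Context {R : realType} {H : hilbertType R}.
Implicit Types (x : R) (u v : H) (S T : H -> H) (f g : R -> R) (p q : {poly R}) (e c : R).
Variable A : H -> H.
Hypothesis hA : positive_op A.

Let bA : bounded_op A. Proof. by case: hA. Qed.
Let lA : linear A. Proof. by have [] := (bounded_opP _).1 bA. Qed.
Let aA : adjoint_op A A. Proof. by case: hA. Qed.

Definition rspec : set R := [set x | spectrum A x%:C].

Lemma rspec_ge0 x : rspec x -> 0 <= x.
Proof. by case: hA => _ _ h /h; rewrite ler0c. Qed.

Lemma spectrum_real z : spectrum A z -> exists2 x, rspec x & z = x%:C.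
Proof.
move=> sz; have z0 : 0 <= z by case: hA => _ _; apply.
exists (complex.Re z); last by rewrite RRe_real// ger0_real.
by rewrite /rspec /= RRe_real// ger0_real.
Qed.

Lemma poly_root_rspec q : q != 0 ->
  (forall K, 0 <= K -> exists u, K * nrm (op_horner q A u) < nrm u) ->
  exists2 x, rspec x & root q x.
Proof.
move=> q0 hq.
have q0' : map_poly (real_complex R) q != 0 by rewrite map_poly_eq0.
have [|z /spectrum_real[x sx ->]] := spectrum_root lA q0'.
  by move=> K K0; have [x hx] := hq K K0; exists x; rewrite -op_hornerE.
rewrite fmorph_root => qx; by exists x.
Qed.

(** Let [m] be the norm of the self-adjoint operator [p(A)]. Vectors almost attaining it show that
    [p(A)^2 - m^2] is not bounded below, so [p^2 - m^2] has a root in the spectrum, and [|p|] equals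
    [m] there. The argument breaks down only when [p^2 - m^2] is the zero polynomial. *)
Lemma op_horner_bnd p c : 0 <= c -> (forall x, rspec x -> `|p.[x]| <= c) ->
  bnd (op_horner p A) c.
Proof.
move=> c0 pc; pose T := op_horner p A.
have bT : bounded_op T by exact: op_horner_bounded.
suff : opnorm T <= c by move=> h; apply: bndW h _; exact: bnd_opnorm.
rewrite leNgt; apply/negP => cm.
have contra x : rspec x -> p.[x] ^+ 2 = opnorm T ^+ 2 -> False.
  move=> /pc px e; have : `|p.[x]| ^+ 2 <= c ^+ 2 by rewrite ler_pXn2r ?nnegrE.
  rewrite real_normK ?num_real// e leNgt => /negP; apply.
  by rewrite ltr_pXn2r// nnegrE// opnorm_ge0.
have main q (S := op_horner q A) : 0 < opnorm S -> q ^+ 2 - (opnorm S ^+ 2)%:P != 0 ->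
    exists2 x, rspec x & q.[x] ^+ 2 = opnorm S ^+ 2.
  move=> m0 n0.
  have bS : bounded_op S by exact: op_horner_bounded.
  have aS : adjoint_op S S by exact: op_horner_adjoint.
  have [|x sx] := poly_root_rspec n0.
    move=> K K0; have [x hx] := norm_attained_approx bS aS m0 K0.
    by exists x; rewrite op_hornerB op_hornerC expr2 op_hornerM.
  rewrite rootE !hornerE subr_eq0 => /eqP e; by exists x.
have m0 : 0 < opnorm T by exact: le_lt_trans cm.
have [p0|p0] := eqVneq (p ^+ 2 - (opnorm T ^+ 2)%:P) 0; last first.
  by have [x sx /(contra _ sx)] := main p m0 p0.
have pT x : p.[x] ^+ 2 = opnorm T ^+ 2.
  by have := congr1 (fun q => q.[x]) p0; rewrite !hornerE => /eqP; rewrite subr_eq0 => /eqP.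
(* [p] is constant: it remains to see that the spectrum is not empty. *)
have hX : op_horner 'X A = A by exact: op_hornerX.
suff [x sx] : exists x, rspec x by exact: (contra x).
(* If [A = 0], then 0 is in the spectrum unless [H] is trivial, which [m0] excludes. Otherwise
   [main] applied to the polynomial ['X] yields a point of the spectrum. *)
have [A0|A0] := eqVneq (opnorm A) 0.
  exists 0; rewrite /rspec /= => -[S [bS _ AS]].
  have h (x : H) : x = 0.
    have := congr1 (@^~ x) AS; rewrite /= => <-.
    suff -> : (A - (0 : R)%:C *: id) (S x) = 0.
      have [lS _] := (bounded_opP _).1 bS.
      by apply: nrm_eq0; rewrite nrm0.
    rewrite !opE rmorph0 scale0r subr0; apply: nrm_eq0; apply/le_anti.
    by rewrite nrm_ge0 andbT; have := bnd_opnorm bA (S x); rewrite A0 mul0r.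
  have : opnorm T <= 0.
    by apply: opnorm_le => // x; rewrite (h (T x)) nrm0 mul0r.
  by rewrite leNgt m0.
have [||x sx _] := main 'X; rewrite ?hX.
- by rewrite lt_neqAle eq_sym A0 opnorm_ge0.
- apply/eqP => /(congr1 (fun q => size q)); rewrite size_poly0.
  by rewrite size_XnsubC.
- by exists x.
Qed.

(** The Neumann series: the [T_ n] are its partial sums, obtained by iterating
    [F |-> (A F - 1) / z], a contraction of ratio [M / z] whose fixed point inverts [A - z]. The
    bound [(z - M)^-1] is stable under the iteration, being the fixed point of
    [c |-> (M c + 1) / z]. *)
Lemma not_rspec_gt (z M : R) : 0 <= M -> bnd A M -> M < z -> ~ rspec z.
Proof.
move=> M0 AM Mz; have z0 : 0 < z by exact: le_lt_trans Mz.
have zM : 0 < z - M by rewrite subr_gt0.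
rewrite /rspec /=; apply.
pose T_ := fix F n : H -> H := if n is m.+1 then z^-1%:C *: (A \o F m - id) else 0.
have TS n : T_ n.+1 = z^-1%:C *: (A \o T_ n - id) by [].
have T0 : T_ 0%N = 0 by [].
have bT n : bounded_op (T_ n).
  elim: n => [|n IH]; first by rewrite T0; exact: bounded0.
  rewrite TS; apply: boundedZ; apply: boundedB; last exact: bounded_id.
  exact: bounded_comp.
have iz : `|z^-1| = z^-1 by rewrite gtr0_norm// invr_gt0.
have Tb n : bnd (T_ n) (z - M)^-1.
  elim: n => [|n IH].
    by move=> x; rewrite T0 op_zeroE nrm0 mulr_ge0 ?nrm_ge0// invr_ge0 ltW.
  rewrite TS; have := bndZr z^-1 (bndB (bnd_comp M0 AM IH) bnd_id).
  apply: bndW; rewrite iz le_eqVlt; apply/orP; left; apply/eqP; field.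
  by rewrite !gt_eqF.
pose rho := M / z.
have rho0 : 0 <= rho by rewrite divr_ge0// ltW.
have rho1 : rho < 1 by rewrite ltr_pdivrMr// mul1r.
have step m n c : bnd (T_ m - T_ n) c -> bnd (T_ m.+1 - T_ n.+1) (rho * c).
  move=> h x.
  have -> : (T_ m.+1 - T_ n.+1) x = z^-1%:C *: A ((T_ m - T_ n) x).
    rewrite !TS !opE /= -scalerBr (linear_mapB lA).
    by rewrite opprB addrA subrK.
  rewrite nrmZr iz (_ : rho * c * nrm x = z^-1 * (M * (c * nrm x))); last first.
    by rewrite /rho; ring.
  rewrite ler_pM2l ?invr_gt0//; apply: le_trans (AM _) _.
  by rewrite ler_wpM2l//; exact: h.
have geo n k : bnd (T_ (n + k)%N - T_ n) (rho ^+ n * (z - M)^-1).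
  elim: n => [|n IH]; first by rewrite expr0 mul1r T0 subr0 add0n; exact: Tb.
  by rewrite addSn exprS -mulrA; exact: step.
have [|T bT' hT] := cauchy_op bT.
  move=> e e0.
  have : rho ^+ n @[n --> \oo] --> 0 by apply: cvg_expr; rewrite ger0_norm.
  have e1 : 0 < e * (z - M) / 2 by rewrite divr_gt0// mulr_gt0.
  move=> /cvgrPdist_lt/(_ _ e1)[n0 _ hn0]; exists n0 => m n.
  have small k : bnd (T_ (n0 + k)%N - T_ n0) (e / 2).
    apply: bndW (geo n0 k); rewrite ler_pdivrMr//.
    have := hn0 n0 (leqnn _); rewrite /= sub0r normrN ger0_norm ?exprn_ge0//.
    lra.
  move=> /subnKC <- /subnKC <-.
  have -> : e = e / 2 + e / 2 by field.
  by apply: bnd_tri (small _) _; apply: bnd_sym; exact: small.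
have Tr (x : H) : A (T x) - z%:C *: T x = x.
  apply/eqP; rewrite -subr_eq0; apply/eqP/nrm_small => e e0.
  have K0 : 0 < (z + M) * (nrm x + 1).
    by rewrite mulr_gt0//; [exact: ltr_pwDl|rewrite ltr_wpDl ?nrm_ge0].
  have [n0 hn0] := hT _ (divr_gt0 e0 K0).
  have h1 := hn0 n0 (leqnn _) x; have h2 := hn0 n0.+1 (leqnSn _) x.
  have -> : A (T x) - z%:C *: T x - x =
      z%:C *: (T_ n0.+1 - T) x - A ((T_ n0 - T) x).
    rewrite TS !opE /= scalerBr scalerA -rmorphM divff ?gt_eqF// scale1r.
    rewrite (linear_mapB lA).
    move: (A (T x)) (A (T_ n0 x)) (z%:C *: T x) => a b t.
    by rewrite opprB [b - x - t + _]addrC -!addrA addKr (addrC (- t)).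
  apply: le_trans (nrmD _ _) _; rewrite nrmN nrmZr (gtr0_norm z0).
  set d := e / _ in h1 h2.
  have h3 : nrm (A ((T_ n0 - T) x)) <= M * (d * nrm x).
    by apply: le_trans (AM _) _; rewrite ler_wpM2l.
  have h4 : z * nrm ((T_ n0.+1 - T) x) <= z * (d * nrm x) by rewrite ler_pM2l.
  apply: le_trans (lerD h4 h3) _; rewrite -mulrDl /d.
  have n1 : 0 < nrm x + 1 by rewrite ltr_wpDl ?nrm_ge0.
  have zM1 : 0 < z + M by rewrite ltr_pwDl.
  have -> : (z + M) * (d * nrm x) = e * (nrm x / (nrm x + 1)).
    rewrite /d; by field; rewrite !gt_eqF.
  by rewrite ger_pMr// ler_pdivrMr// mul1r lerDl.
(* The limit is a right inverse of [A - z]; injectivity makes it a left inverse as well. *)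
have inj u v : A u - z%:C *: u = A v - z%:C *: v -> u = v.
  move=> uv; apply/eqP; rewrite -subr_eq0; apply/eqP/nrm_eq0/le_anti.
  rewrite nrm_ge0 andbT.
  have Auv : A (u - v) = z%:C *: (u - v).
    rewrite (linear_mapB lA) scalerBr (canRL (subrK _) uv).
    by rewrite -addrA addrC subrKA.
  have := AM (u - v); rewrite Auv nrmZr (gtr0_norm z0) => h.
  have : (z - M) * nrm (u - v) <= 0 by rewrite mulrBl subr_le0.
  by rewrite pmulr_rle0.
exists T; split=> //; apply/funext => x /=.
  by apply: inj; rewrite Tr.
exact: Tr.
Qed.

Lemma rspec_bounded : exists2 M, 0 < M & forall x, rspec x -> 0 <= x <= M.
Proof.
have [_ [M M0 AM]] := (bounded_opP _).1 bA.
exists (M + 1); first by rewrite ltr_wpDl.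
move=> x sx; rewrite rspec_ge0//= leNgt; apply/negP => Mx.
by apply: (@not_rspec_gt x M) sx => //; lra.
Qed.

End PositiveOperator.

Section UniformApproximation.
Context {R : realType}.

Lemma cvg_uniformP (S : set R) (f_ : nat -> R -> R) (f : R -> R) :
  {uniform S, f_ @ \oo --> f} <->
  forall e : R, 0 < e -> exists n0, forall n, (n0 <= n)%N ->
    forall x, S x -> `|f x - f_ n x| < e.
Proof.
split=> [h e e0|h P /uniform_nbhs[E [entE subP]]].
  have [|n0 _ hn] := h [set g | forall y, S y -> `|f y - g y| < e].
    apply/uniform_nbhs; exists [set xy | ball xy.1 e xy.2]; split=> //.
    by rewrite -entourage_ballE; exists e.
  by exists n0 => n nn; exact: hn.
move: entE; rewrite -entourage_ballE => -[e /= e0 eE].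
have [n0 hn] := h e e0; exists n0 => // n /= nn.
by apply: subP => y Sy; apply: eE; exact: hn.
Qed.

Lemma cvg0P (u : nat -> R) : (forall n, 0 <= u n) ->
  u n @[n --> \oo] --> (0 : R) <->
  forall e : R, 0 < e -> exists n0, forall n, (n0 <= n)%N -> u n < e.
Proof.
move=> u0; split=> [/cvgrPdist_lt h e e0|h].
  have [n0 _ hn] := h _ e0; exists n0 => n nn.
  by have := hn n nn; rewrite /= sub0r normrN ger0_norm.
apply/cvgrPdist_lt => e e0; have [n0 hn] := h e e0; exists n0 => // n /= nn.
by rewrite sub0r normrN ger0_norm// hn.
Qed.

Lemma le0_small (r : R) : (forall e : R, 0 < e -> r <= e) -> r <= 0.
Proof. by move=> h; apply/ler_addgt0Pr => e e0; rewrite add0r h. Qed.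

Lemma invS_small (e : R) : 0 < e -> exists n0, forall n, (n0 <= n)%N ->
  n.+1%:R^-1 < e.
Proof.
move=> e0; exists (Num.truncn e^-1) => n nn.
rewrite invf_plt ?posrE ?ltr0n//; apply: (lt_le_trans (truncnS_gt _)).
by rewrite ler_nat ltnS.
Qed.

Lemma invS_gt0 n : 0 < n.+1%:R^-1 :> R.
Proof. by rewrite invr_gt0 ltr0n. Qed.

End UniformApproximation.

(** * Continuous functional calculus *)

Section FunctionalCalculus.
Context {R : realType} {H : hilbertType R}.
Implicit Types (x : R) (u v : H) (S T : H -> H) (f g : R -> R) (p q : {poly R}) (d e c M : R).
Variable A : H -> H.
Hypothesis hA : positive_op A.

Let bA : bounded_op A. Proof. by case: hA. Qed.
Let lA : linear A. Proof. by have [] := (bounded_opP _).1 bA. Qed.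
Let aA : adjoint_op A A. Proof. by case: hA. Qed.

(* [calc f T] says that [T] is [f(A)]; unlike [is_op_fun] it needs no
   approximating sequence. *)
Definition calc f T := bounded_op T /\ forall e, 0 < e ->
  exists2 p, (forall x, rspec A x -> `|f x - p.[x]| <= e) & bnd (op_horner p A - T) e.

Lemma op_horner_sub_bnd p q c : 0 <= c -> (forall x, rspec A x -> `|p.[x] - q.[x]| <= c) ->
  bnd (op_horner p A - op_horner q A) c.
Proof.
move=> c0 pq; rewrite -op_hornerB; apply: op_horner_bnd => // x sx.
by rewrite !hornerE pq.
Qed.

(** Any polynomial close to [f] on the spectrum is close to the polynomials that define [T], hence
    so are the operators. This makes the calculus independent of the approximation and gives
    uniqueness. *)
Lemma calc_approx f T p c d : calc f T -> 0 <= c -> c < d ->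
  (forall x, rspec A x -> `|f x - p.[x]| <= c) -> bnd (op_horner p A - T) d.
Proof.
move=> [_ hf] c0 cd fp; have e0 : 0 < (d - c) / 2 by lra.
have [q fq qT] := hf _ e0.
have -> : d = (c + (d - c) / 2) + (d - c) / 2 by field.
apply: bnd_tri qT; apply: op_horner_sub_bnd; first lra.
move=> x sx; apply: le_trans (ler_distD (f x) _ _) _.
by rewrite lerD ?fq// distrC fp.
Qed.

Lemma calc_unique f T T' : calc f T -> calc f T' -> T = T'.
Proof.
move=> cT cT'; apply/eqP; rewrite -subr_eq0; apply/eqP/bnd_small => e e0.
have e4 : 0 < e / 4 by lra.
have [_ /(_ _ e4)[p fp _]] := cT.
have -> : e = e / 2 + e / 2 by field.
apply: (@bnd_tri _ _ _ (op_horner p A)).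
  by apply: bnd_sym; apply: (calc_approx cT _ _ fp); lra.
by apply: (calc_approx cT' _ _ fp); lra.
Qed.

Lemma is_op_funP f T : is_op_fun f A T <-> calc f T.
Proof.
split=> -[bT].
  move=> [p_ [/cvg_uniformP fp]].
  have bpT n : bounded_op (op_horner (p_ n) A - T).
    by apply: boundedB => //; exact: op_horner_bounded.
  move=> /cvg0P -/(_ (fun n => opnorm_ge0 (bpT n))) pT.
  split=> // e e0; have [n0 h0] := fp e e0; have [n1 h1] := pT e e0.
  pose n := maxn n0 n1; exists (p_ n).
    by move=> x sx; apply/ltW/h0 => //; exact: leq_maxl.
  by apply: bndW (bnd_opnorm (bpT n)); apply/ltW/h1; exact: leq_maxr.
move=> hf.
have /choice[p_ hp] n : exists p, (forall x, rspec A x -> `|f x - p.[x]| <= n.+1%:R^-1) /\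
    bnd (op_horner p A - T) n.+1%:R^-1.
  by have [p h1 h2] := hf _ (invS_gt0 n); exists p.
split=> //; exists p_; split.
  apply/cvg_uniformP => e e0; have [n0 hn] := invS_small e0.
  by exists n0 => n nn x sx; apply: le_lt_trans (hn n nn); exact: (hp n).1.
have bpT n : bounded_op (op_horner (p_ n) A - T).
  by apply: boundedB => //; exact: op_horner_bounded.
apply/cvg0P => [n|e e0]; first exact: opnorm_ge0.
have [n0 hn] := invS_small e0; exists n0 => n nn; apply: le_lt_trans (hn n nn).
by apply: opnorm_le (hp n).2; rewrite ltW.
Qed.

Lemma calc_op_fun f T : calc f T -> op_fun f A = T.
Proof.
move=> cT; apply: (@calc_unique f) => //; apply/is_op_funP.
apply: (@xgetI _ 0 [set T | is_op_fun f A T] T).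
exact/is_op_funP.
Qed.

(** Continuity on the whole line allows Weierstrass approximation on an interval containing the
    spectrum. A function that is well behaved only on the spectrum is reached through [calc_ext]. *)
Lemma calc_exists f : continuous f -> exists T, calc f T.
Proof.
move=> cf; have [M M0 hM] := rspec_bounded hA.
have /choice[p_ hp] n : exists p, forall x, rspec A x -> `|f x - p.[x]| <= n.+1%:R^-1.
  have [p h] := weierstrass cf M0 (invS_gt0 n); exists p => x sx.
  by apply: h; exact: hM.
have [||T bT hT] := @cauchy_op _ _ (fun n => op_horner (p_ n) A).
- by move=> n; exact: op_horner_bounded.
- move=> e e0; have e2 : 0 < e / 2 by lra.
  have [n0 hn] := invS_small e2; exists n0 => m n /hn hm' /hn hn'.
  apply: op_horner_sub_bnd; first lra.
  move=> x sx; apply: le_trans (ler_distD (f x) _ _) _.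
  have h1 := le_trans (hp m x sx) (ltW hm').
  have h2 := le_trans (hp n x sx) (ltW hn').
  by rewrite (distrC _ (f x)) (splitr e) lerD.
exists T; split=> // e e0.
have [n0 h0] := hT e e0; have [n1 h1] := invS_small e0.
pose n := maxn n0 n1; exists (p_ n).
  move=> x sx; apply: le_trans (hp n x sx) _; apply/ltW/h1; exact: leq_maxr.
by apply: h0; exact: leq_maxl.
Qed.

Lemma calcP f : continuous f -> calc f (op_fun f A).
Proof. by move=> /calc_exists[T cT]; rewrite (calc_op_fun cT). Qed.

Lemma calc_ext f g T : (forall x, rspec A x -> f x = g x) -> calc f T -> calc g T.
Proof.
move=> fg [bT hf]; split=> // e e0; have [p fp pT] := hf e e0.
by exists p => // x sx; rewrite -fg ?fp.
Qed.

Lemma calc_lin c f g S T : calc f S -> calc g T ->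
  calc (fun x => c * f x + g x) (c%:C *: S + T).
Proof.
move=> [bS hf] [bT hg]; split; first exact: bounded_lin.
move=> e e0; have c1 : 0 < `|c| + 1 by rewrite ltr_wpDl.
have d0 : 0 < e / 2 / (`|c| + 1) by rewrite !divr_gt0.
have e2 : 0 < e / 2 by lra.
have [p fp pS] := hf _ d0; have [q gq qT] := hg _ e2.
have cd : `|c| * (e / 2 / (`|c| + 1)) <= e / 2.
  by rewrite mulrCA ger_pMr// ler_pdivrMr// mul1r lerDl.
exists (c *: p + q).
  move=> x sx; rewrite !hornerE.
  have -> : c * f x + g x - (c * p.[x] + q.[x]) = c * (f x - p.[x]) + (g x - q.[x]) by ring.
  apply: le_trans (ler_normD _ _) _; rewrite normrM.
  have := ler_wpM2l (normr_ge0 c) (fp x sx); have := gq x sx; lra.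
rewrite op_hornerD op_hornerZ opprD addrACA -scalerBr.
apply: bndW (bndD (bndZr c pS) qT); lra.
Qed.

Lemma calc_cst c : calc (fun=> c) (c%:C *: (id : H -> H)).
Proof.
split; first by apply: boundedZ; exact: bounded_id.
move=> e e0; exists c%:P; first by move=> x _; rewrite hornerC subrr normr0 ltW.
rewrite op_hornerC subrr => x; rewrite op_zeroE nrm0 mulr_ge0 ?nrm_ge0//.
exact: ltW.
Qed.

Lemma calc_id : calc id A.
Proof.
split=> // e e0; exists 'X; first by move=> x _; rewrite hornerX subrr normr0 ltW.
rewrite op_hornerX subrr => x; rewrite op_zeroE nrm0 mulr_ge0 ?nrm_ge0//.
exact: ltW.
Qed.

Lemma poly_bounded p M : 0 < M -> exists2 c, 0 <= c & forall x, 0 <= x <= M -> `|p.[x]| <= c.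
Proof.
move=> M0; have cn : {within `[0, M], continuous (fun x => `|p.[x]|)}.
  apply: continuous_subspaceT => x.
  by apply: continuous_comp; [exact: continuous_horner|exact: norm_continuous].
have [m _ hm] := EVT_max (ltW M0) cn.
exists `|p.[m]| => // x xM; apply: hm; by rewrite in_itv.
Qed.

Lemma calc_bounded f T : calc f T -> exists2 c, 0 <= c & forall x, rspec A x -> `|f x| <= c.
Proof.
move=> [_ /(_ _ ltr01)[p fp _]]; have [M M0 hM] := rspec_bounded hA.
have [c c0 pc] := poly_bounded p M0.
exists (1 + c); first by rewrite addr_ge0.
move=> x sx; have := ler_normD (f x - p.[x]) p.[x]; rewrite subrK.
have := fp x sx; have := pc x (hM x sx); lra.
Qed.

Lemma calcM f g S T : calc f S -> calc g T -> calc (fun x => f x * g x) (S \o T).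
Proof.
move=> cf cg; have [c c0 fc] := calc_bounded cf; have [d d0 gd] := calc_bounded cg.
have [[bS hf] [bT hg]] := (cf, cg).
have [lS [s s0 Ss]] := (bounded_opP _).1 bS.
have [_ [t t0 Tt]] := (bounded_opP _).1 bT.
split; first exact: bounded_comp.
move=> e e0; pose K := c + d + s + t + 1.
have K0 : 0 < K by rewrite /K; lra.
(* Since [a <= 1] absorbs [a * a] into [a], the sum [K] dominates the coefficients of [a] in both
   errors, the one for the functions and the one for the operators. *)
pose a := Num.min 1 (e / K).
have a0 : 0 < a by rewrite lt_min ltr01 divr_gt0.
have a1 : a <= 1 by rewrite ge_min lexx.
have aK : a * K <= e by rewrite -ler_pdivlMr// ge_min lexx orbT.
have cad : c * a <= e /\ a * a + (c + d) * a <= e /\ s * a + a * (t + a) <= e.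
  have aa : a * a <= a by rewrite ger_pMr.
  have sa : 0 <= s * a by rewrite mulr_ge0// ltW.
  have ta : 0 <= t * a by rewrite mulr_ge0// ltW.
  have ca : 0 <= c * a by rewrite mulr_ge0// ltW.
  have da : 0 <= d * a by rewrite mulr_ge0// ltW.
  by move: aK; rewrite /K !mulrDr mulr1 => aK; split; [|split]; lra.
have [p fp pS] := hf _ a0; have [q gq qT] := hg _ a0.
exists (p * q).
  move=> x sx; rewrite hornerM.
  have -> : f x * g x - p.[x] * q.[x] =
     f x * (g x - q.[x]) + (f x - p.[x]) * g x - (f x - p.[x]) * (g x - q.[x]) by ring.
  apply: le_trans (ler_normB _ _) _.
  apply: le_trans (lerD (ler_normD _ _) (lexx _)) _; rewrite !normrM.
  have h1 := ler_pM (normr_ge0 _) (normr_ge0 _) (fc x sx) (gq x sx).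
  have h2 := ler_pM (normr_ge0 _) (normr_ge0 _) (fp x sx) (gd x sx).
  have h3 := ler_pM (normr_ge0 _) (normr_ge0 _) (fp x sx) (gq x sx).
  case: cad => _ [+ _]; lra.
rewrite op_hornerM//.
have -> : (op_horner p A \o op_horner q A) - (S \o T) =
    (S \o (op_horner q A - T)) + ((op_horner p A - S) \o op_horner q A).
  apply/funext => u; rewrite !opE /= (linear_mapB lS) !opE.
  by rewrite [RHS]addrC subrKA.
have qb : bnd (op_horner q A) (t + a).
  by rewrite (_ : op_horner q A = T + (op_horner q A - T)); [exact: bndD|rewrite addrC subrK].
apply: bndW (bndD (bnd_comp s0 Ss qT) (bnd_comp (ltW a0) pS qb)).
by case: cad => _ [_].
Qed.

Lemma calc_adjoint f T : calc f T -> adjoint_op T T.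
Proof.
move=> [bT hf] u v; apply/eqP; rewrite -subr_eq0; apply/eqP/normr0_eq0.
set w := `| _ |; have wreal : w \is Num.real by exact: normr_real.
have w0 : 0 <= w by exact: normr_ge0.
have [r r0 wr] : exists2 r : R, 0 <= r & w = r%:C.
  by exists (complex.Re w); rewrite -?ler0c RRe_real.
rewrite wr; congr (_%:C); apply/le_anti; rewrite r0 andbT.
apply: le0_small => e e0.
have K0 : 0 < 2 * (nrm u * nrm v) + 1 by rewrite ltr_wpDl// !mulr_ge0 ?nrm_ge0.
have [p _ pT] := hf _ (divr_gt0 e0 K0).
set d := e / _ in pT.
suff h : w <= (2 * d * (nrm u * nrm v))%:C.
  move: h; rewrite wr lecR => h; apply: le_trans h _.
  rewrite /d; set k := nrm u * nrm v in K0 *.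
  have -> : 2 * (e / (2 * k + 1)) * k = e * (2 * k / (2 * k + 1)) by field; rewrite gt_eqF.
  by rewrite ger_pMr// ler_pdivrMr// mul1r lerDl.
have -> : w = `|inner u ((op_horner p A - T) v) - inner ((op_horner p A - T) u) v|.
  rewrite /w !opE linearBr /= linearBl /=.
  rewrite (op_horner_adjoint p aA u v).
  move: (inner (T u) v) (inner u (T v)) (inner u _) => a b c'.
  by congr `| _ |; ring.
apply: le_trans (ler_normB _ _) _.
apply: le_trans (lerD (inner_cauchy_schwarz _ _) (inner_cauchy_schwarz _ _)) _.
rewrite -rmorphD lecR.
have h1 : nrm u * nrm ((op_horner p A - T) v) <= nrm u * (d * nrm v).
  by rewrite ler_wpM2l ?nrm_ge0.
have h2 : nrm ((op_horner p A - T) u) * nrm v <= d * nrm u * nrm v.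
  by rewrite ler_wpM2r ?nrm_ge0.
lra.
Qed.

End FunctionalCalculus.

(** * Unitaries from the functional calculus and norm estimates *)

Section UnitaryCalculus.
Context {R : realType} {H : hilbertType R}.
Implicit Types (S T W : H -> H) (f g : R -> R) (c : R).
Variable A : H -> H.
Hypothesis hA : positive_op A.

(** The function [f + i g] has modulus 1 on the spectrum, and [S - i T] is the adjoint and inverse.
    The two parts stay separate because [calc] is a calculus of real functions. *)
Lemma calc_unitary f g S T : calc A f S -> calc A g T ->
  (forall x, rspec A x -> f x ^+ 2 + g x ^+ 2 = 1) ->
  unitary_op (S + 'i%C *: T).
Proof.
move=> cf cg fg1; have [bS _] := cf; have [bT _] := cg.
have [lS _] := (bounded_opP _).1 bS; have [lT _] := (bounded_opP _).1 bT.
have bi z : bounded_op (S + z *: T) by apply: boundedD => //; exact: boundedZ.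
have one : (S \o S) + (T \o T) = id.
  have c1 := calc_lin 1 (calcM hA cf cf) (calcM hA cg cg).
  rewrite rmorph1 scale1r in c1; apply: (calc_unique hA c1).
  have := @calc_cst _ _ A 1; rewrite rmorph1 scale1r; apply: calc_ext => x sx.
  by rewrite mul1r -!expr2 fg1.
have comm : S \o T = T \o S.
  apply: (calc_unique hA (calcM hA cf cg)).
  by apply: calc_ext (calcM hA cg cf) => x _; rewrite mulrC.
have inv z w : z + w = 0 -> z * w = 1 ->
    (S + z *: T) \o (S + w *: T) = id.
  move=> zw0 zw1; rewrite -[RHS]one; apply/funext => u; rewrite /= !opE /=.
  rewrite (linear_mapD lS) (linear_mapD lT) !(linear_mapZ lS) !(linear_mapZ lT).
  have := congr1 (@^~ u) comm => /= ->.
  rewrite scalerDr scalerA zw1 scale1r -addrA; congr (_ + _).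
  by rewrite addrA -scalerDl addrC [w + z]addrC zw0 scale0r addr0.
have i2 : 'i%C * 'i%C = -1 :> R[i] by rewrite -expr2 sqr_i.
split=> //; exists (S + (- 'i%C) *: T); split=> //.
- move=> u v; rewrite !opE linearDl /= linearDr /= innerZl innerZr.
  rewrite (calc_adjoint hA cf) (calc_adjoint hA cg); congr (_ + _ * _).
  by apply/eqP; rewrite eq_complex /= oppr0 opprK !eqxx.
- by apply: inv; rewrite ?subrr// mulrN i2 opprK.
- by apply: inv; rewrite ?addNr// mulNr i2 opprK.
Qed.

Lemma sqrt_one_sub_continuous f : continuous f ->
  continuous (fun x => Num.sqrt (1 - f x ^+ 2)).
Proof.
move=> cf x; apply: (@continuous_comp _ _ _ (fun x => 1 - f x ^+ 2) Num.sqrt).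
  apply: cvgB; first exact: cvg_cst.
  by under eq_fun do rewrite expr2; rewrite expr2; apply: cvgM; exact: cf.
exact: sqrt_continuous.
Qed.

(** A real [y] with [|y| <= 1] is the mean of the two numbers [y + i s] and [y - i s] of modulus 1,
    where [s = sqrt (1 - y^2)]. Thus unitary invariance and the triangle inequality bound the
    multiplication by [T] in the norm [N]. *)
Lemma calc_contraction f T c : continuous f -> calc A f T -> 0 < c ->
  (forall x, rspec A x -> `|f x| <= c) ->
  exists U V, [/\ unitary_op U, unitary_op V & T = (c / 2)%:C *: (U + V)].
Proof.
move=> cf cT c0 fc; pose g x := c^-1 * f x + 0.
have cg : continuous g.
  by move=> x; apply: cvgD; [apply: cvgMl_tmp; exact: cf|exact: cvg_cst].
have cs := sqrt_one_sub_continuous cg.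
have cG := calc_lin c^-1 cT (calc_cst A 0).
have [S cS] := calc_exists hA cs.
have cS' := calc_lin (-1) cS (calc_cst A 0).
rewrite -/g rmorph0 scale0r addr0 in cG; rewrite rmorph0 scale0r addr0 in cS'.
have gs x : rspec A x -> g x ^+ 2 + Num.sqrt (1 - g x ^+ 2) ^+ 2 = 1.
  move=> sx; rewrite sqr_sqrtr ?subrKC// subr_ge0 -real_normK ?num_real//.
  rewrite expr_le1// /g addr0 normrM gtr0_norm ?invr_gt0//.
  by rewrite mulrC ler_pdivrMr// mul1r fc.
exists ((c^-1)%:C *: T + 'i%C *: S), ((c^-1)%:C *: T + 'i%C *: ((-1)%:C *: S)); split.
- exact: (calc_unitary cG cS).
- by apply: (calc_unitary cG cS') => x sx; rewrite mulN1r addr0 sqrrN gs.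
- rewrite rmorphN1 scaleN1r scalerN addrACA subrr addr0 -scalerDl scalerA.
  rewrite -rmorphD -rmorphM (_ : c / 2 * _ = 1) ?rmorph1 ?scale1r//.
  by field; rewrite gt_eqF.
Qed.

(* To first order in [t], the unitary is [1 + i t T]. *)
Lemma calc_near_unitary f T m t : continuous f -> calc A f T -> 0 < m -> 0 < t ->
  t * m <= 1 -> (forall x, rspec A x -> `|f x| <= m) ->
  exists U S g, [/\ unitary_op U, continuous g, calc A g S,
    (forall x, rspec A x -> `|g x| <= (t * m) ^+ 2) &
    U = (id + 'i%C *: (t%:C *: T)) + S].
Proof.
move=> cf cT m0 t0 tm fm; pose g x := t * f x + 0.
have cg : continuous g.
  by move=> x; apply: cvgD; [apply: cvgMl_tmp; exact: cf|exact: cvg_cst].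
have cs := sqrt_one_sub_continuous cg.
have cG := calc_lin t cT (calc_cst A 0).
rewrite -/g rmorph0 scale0r addr0 in cG.
have [S cS] := calc_exists hA cs.
have cS1 := calc_lin (-1) (calc_cst A 1) cS.
have gtm x : rspec A x -> g x ^+ 2 <= (t * m) ^+ 2.
  move=> sx; rewrite -(real_normK (num_real (g x))) ler_pXn2r ?nnegrE//; last first.
    by rewrite mulr_ge0// ltW.
  by rewrite /g addr0 normrM gtr0_norm// ler_pM2l// fm.
have tm1 : (t * m) ^+ 2 <= 1 by rewrite expr_le1// mulr_ge0// ltW.
(* The unitary is [sqrt (1 - (t f)^2) + i t f], and its real part differs from 1 by at most
   [(t f)^2] because [1 - sqrt (1 - y) <= y] on [[0, 1]]. *)
exists (S + 'i%C *: (t%:C *: T)), ((-1)%:C *: (1%:C *: id) + S).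
exists (fun x => -1 * 1 + Num.sqrt (1 - g x ^+ 2)); split=> //.
- apply: calc_unitary cS cG _ => x sx; rewrite sqr_sqrtr ?subrK//.
  by rewrite subr_ge0 (le_trans (gtm x sx)).
- by move=> x; apply: cvgD; [exact: cvg_cst|exact: cs].
- move=> x sx; have g1 := gtm x sx; set y := g x ^+ 2 in g1 *.
  have y0 : 0 <= y by exact: sqr_ge0.
  have : Num.sqrt (1 - y) ^+ 2 = 1 - y by rewrite sqr_sqrtr; lra.
  have := sqrtr_ge0 (1 - y); move: (Num.sqrt _) => k k0 ky.
  have k1 : k <= 1 by rewrite -(@ler_pXn2r _ 2) ?nnegrE ?ler01// ky expr1n; lra.
  rewrite mulN1r ler0_norm; last lra.
  apply: le_trans g1; have : k ^+ 2 <= k by rewrite expr2 ler_piMl.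
  lra.
- by rewrite rmorphN1 rmorph1 scaleN1r scale1r addrACA subrr add0r addrC.
Qed.

End UnitaryCalculus.

(** * Norm ideals and dissipative perturbations *)

Section NormIdeal.
Context {R : realType} {H : hilbertType R}.
Implicit Types (S T U V W X Y : H -> H) (f g : R -> R) (c t : R).
Variables (J : set (H -> H)) (N : (H -> H) -> R).
Hypothesis hN : unitarily_invariant_norm J N.

Let hJ : norm_ideal J N. Proof. by case: hN. Qed.

Lemma ideal_linear_op W : J W -> linear W.
Proof. by move=> /(ideal_bounded hJ)/bounded_opP[]. Qed.

Lemma idealD X Y : J X -> J Y -> J (X + Y).
Proof. by move=> jX jY; have := ideal_linear hJ 1 jX jY; rewrite scale1r. Qed.

Lemma idealZ (z : R[i]) X : J X -> J (z *: X).
Proof. by move=> jX; have := ideal_linear hJ z jX (ideal0 hJ); rewrite addr0. Qed.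

Lemma idealN X : J X -> J (- X).
Proof. by move=> jX; rewrite -scaleN1r; exact: idealZ. Qed.

Lemma idealB X Y : J X -> J Y -> J (X - Y).
Proof. by move=> jX /idealN; exact: idealD. Qed.

Lemma ideal_compl S X : bounded_op S -> J X -> J (S \o X).
Proof. by move=> bS jX; exact: (ideal_comp hJ bS bounded_id jX). Qed.

Lemma ideal_compr S X : bounded_op S -> J X -> J (X \o S).
Proof. by move=> bS jX; exact: (ideal_comp hJ bounded_id bS jX). Qed.

Lemma ideal_normN X : J X -> N (- X) = N X.
Proof. by move=> jX; rewrite -scaleN1r (ideal_normZ hJ)// normrN1 /= mul1r. Qed.

Lemma ideal_normZr c X : J X -> N (c%:C *: X) = `|c| * N X.
Proof. by move=> jX; rewrite (ideal_normZ hJ)// Re_norm_real. Qed.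

Lemma ideal_normZi X : J X -> N ('i%C *: X) = N X.
Proof.
move=> jX; rewrite (ideal_normZ hJ)// normc_def /=.
by rewrite expr0n add0r expr1n sqrtr1 mul1r.
Qed.

Lemma ideal_norm_ge0 X : J X -> 0 <= N X.
Proof.
move=> jX; have := ideal_normD hJ jX (idealN jX).
rewrite subrr (ideal_normN jX).
by have := ideal_normZr 0 (ideal0 hJ); rewrite scaler0 normr0 mul0r => ->; lra.
Qed.

Lemma ideal_normB X Y : J X -> J Y -> N (X - Y) <= N X + N Y.
Proof.
by move=> jX jY; rewrite -(ideal_normN jY); exact: (ideal_normD hJ jX (idealN jY)).
Qed.

Lemma ideal_norm_tri X Y : J X -> J Y -> N X <= N Y + N (X - Y).
Proof.
by move=> jX jY; have := ideal_normD hJ jY (idealB jX jY); rewrite subrKC.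
Qed.

Lemma unitary_id : unitary_op (id : H -> H).
Proof.
have b1 := @bounded_id R H; split=> //.
by exists id; split.
Qed.

Lemma unitary_bounded U : unitary_op U -> bounded_op U. Proof. by case. Qed.

Lemma norm_unitaryl U W : unitary_op U -> J W -> N (U \o W) = N W.
Proof. by case: hN => _ h uU jW; rewrite -[RHS](h _ _ _ uU unitary_id jW). Qed.

Lemma norm_unitaryr U W : unitary_op U -> J W -> N (W \o U) = N W.
Proof. by case: hN => _ h uU jW; rewrite -[RHS](h _ _ _ unitary_id uU jW). Qed.

Lemma norm_mull A f T c W : positive_op A -> continuous f -> calc A f T -> 0 < c ->
  (forall x, rspec A x -> `|f x| <= c) -> J W -> N (T \o W) <= c * N W.
Proof.
move=> hA cf cT c0 fc jW.
have [U [V [uU uV ->]]] := calc_contraction hA cf cT c0 fc.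
have jU := ideal_compl (unitary_bounded uU) jW.
have jV := ideal_compl (unitary_bounded uV) jW.
rewrite (_ : _ \o W = (c / 2)%:C *: ((U \o W) + (V \o W)))//.
rewrite ideal_normZr; last exact: idealD.
have := ideal_normD hJ jU jV; rewrite (norm_unitaryl uU)// (norm_unitaryl uV)//.
have -> : c * N W = c / 2 * (N W + N W) by field.
by rewrite gtr0_norm ?divr_gt0// ler_pM2l ?divr_gt0.
Qed.

Lemma norm_mulr B f T c W : positive_op B -> continuous f -> calc B f T -> 0 < c ->
  (forall x, rspec B x -> `|f x| <= c) -> J W -> N (W \o T) <= c * N W.
Proof.
move=> hB cf cT c0 fc jW.
have [U [V [uU uV ->]]] := calc_contraction hB cf cT c0 fc.
have jU := ideal_compr (unitary_bounded uU) jW.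
have jV := ideal_compr (unitary_bounded uV) jW.
have lW := ideal_linear_op jW.
rewrite (_ : W \o _ = (c / 2)%:C *: ((W \o U) + (W \o V))); last first.
  by apply/funext => u /=; rewrite op_scaleE (linear_mapZ lW) (linear_mapD lW).
rewrite ideal_normZr; last exact: idealD.
have := ideal_normD hJ jU jV; rewrite (norm_unitaryr uU)// (norm_unitaryr uV)//.
have -> : c * N W = c / 2 * (N W + N W) by field.
by rewrite gtr0_norm ?divr_gt0// ler_pM2l ?divr_gt0.
Qed.

Variables (A B : H -> H).
Hypotheses (hA : positive_op A) (hB : positive_op B).

(* Conjugating [W] by unitaries [U = 1 + i t P + O(t^2)] and
   [V = 1 - i t Q + O(t^2)] gives [N W <= N (W + t G) + O(t^2)]; convexity of [N]
   along the segment from [W] to [W + G] removes the error term. *)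
Section dissipative.
Variables (f g : R -> R) (P Q W : H -> H).
Hypotheses (cf : continuous f) (cg : continuous g).
Hypotheses (cP : calc A f P) (cQ : calc B g Q) (jW : J W).

Let G := 'i%C *: ((P \o W) - (W \o Q)).

Let jPW : J (P \o W). Proof. by apply: ideal_compl => //; case: cP. Qed.
Let jWQ : J (W \o Q). Proof. by apply: ideal_compr => //; case: cQ. Qed.
Let jG : J G. Proof. by apply: idealZ; exact: idealB. Qed.

Let second_order : exists2 m, 0 < m & forall t, 0 < t -> t * m <= 1 ->
  N W <= N (W + t%:C *: G) + 4 * (t * m) ^+ 2 * N W.
Proof.
have [mf f0 fm] := calc_bounded hA cP; have [mg g0 gm] := calc_bounded hB cQ.
pose m := mf + mg + 1; have m0 : 0 < m by rewrite /m; lra.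
have fm' x : rspec A x -> `|f x| <= m by move=> /fm; rewrite /m; lra.
have gm' x : rspec B x -> `|g x| <= m by move=> /gm; rewrite /m; lra.
exists m => // t t0 tm.
have [U [E1 [e1 [uU ce1 cE1 e1m UE]]]] := calc_near_unitary hA cf cP m0 t0 tm fm'.
have cQN := calc_lin (-1) cQ (calc_cst B 0).
have cgN : continuous (fun x => -1 * g x + 0).
  by move=> x; apply: cvgD; [apply: cvgMl_tmp; exact: cg|exact: cvg_cst].
have gmN x : rspec B x -> `|-1 * g x + 0| <= m.
  by move=> sx; rewrite addr0 mulN1r normrN gm'.
have [V [E2 [e2 [uV ce2 cE2 e2m VE]]]] := calc_near_unitary hB cgN cQN m0 t0 tm gmN.
rewrite rmorph0 scale0r addr0 rmorphN1 scaleN1r in VE.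
have tm2 : 0 < (t * m) ^+ 2 by rewrite exprn_gt0// mulr_gt0.
have [bP _] := cP; have [lP _] := (bounded_opP _).1 bP.
have [bE1 _] := cE1; have [bE2 _] := cE2; have [bQ _] := cQ.
have lW := ideal_linear_op jW.
have jWV := ideal_compr (unitary_bounded uV) jW.
have jE1 := ideal_compl bE1 jWV; have jE2 := ideal_compr bE2 jW.
have jPE2 := ideal_compl bP jE2; have jPWQ := ideal_compl bP jWQ.
pose it := 'i%C * t%:C : R[i].
have itE (X : H -> H) : it *: X = 'i%C *: (t%:C *: X) by rewrite scalerA.
have nit X : J X -> N (it *: X) = t * N X.
  move=> jX; rewrite itE ideal_normZi; last exact: idealZ.
  by rewrite ideal_normZr// gtr0_norm.
(* With [U = 1 + i t P + E1] and [V = 1 - i t Q + E2], the product [W V] is left unexpanded behind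
   [E1]. Each of the four terms of [Z] then has norm at most [(t m)^2 N W], which is the origin of
   the constant 4. *)
pose Z := (W \o E2) + it *: (P \o (W \o E2)) - (it * it) *: (P \o (W \o Q)) +
  (E1 \o (W \o V)).
have expand : U \o (W \o V) = (W + t%:C *: G) + Z.
  have WV u : (W \o V) u = W u - it *: W (Q u) + W (E2 u).
    rewrite /= VE !opE /= (linear_mapD lW) (linear_mapD lW) (linear_mapZ lW).
    by rewrite (linear_mapZ lW) (linear_mapN lW) !scalerN scalerA.
  have PWV u : P ((W \o V) u) = P (W u) - it *: P (W (Q u)) + P (W (E2 u)).
    by rewrite WV (linear_mapD lP) (linear_mapB lP) (linear_mapZ lP).
  apply/funext => u; transitivity (U ((W \o V) u)) => //.
  have E1u : (E1 \o (W \o V)) u = E1 ((W \o V) u) by [].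
  rewrite {1}UE /G /Z !opE E1u; move: (E1 _) => k /=.
  rewrite -[P (W (V u))]/(P ((W \o V) u)) PWV -[W (V u)]/((W \o V) u) WV.
  rewrite !scalerA -/it (mulrC t%:C) -/it !scalerDr !scalerN scalerA.
  by rewrite (AC (3*3*1) ((1*(4*2))*(((3*6)*5)*7))).
have jZ : J Z.
  apply: idealD => //; apply: idealB; last exact: idealZ.
  by apply: idealD => //; exact: idealZ.
have nWV : N (W \o V) = N W by exact: norm_unitaryr.
have nU : N (U \o (W \o V)) = N W by rewrite norm_unitaryl.
have W0 := ideal_norm_ge0 jW.
have n1 := norm_mull hA ce1 cE1 tm2 e1m jWV; rewrite nWV in n1.
have n2 := norm_mulr hB ce2 cE2 tm2 e2m jW.
have n3 := norm_mull hA cf cP m0 fm' jE2.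
have n4 := norm_mull hA cf cP m0 fm' jWQ.
have n5 := norm_mulr hB cg cQ m0 gm' jW.
have jG1 : J (W + t%:C *: G) by apply: idealD => //; exact: idealZ.
apply: (@le_trans _ _ (N (W + t%:C *: G) + N Z)).
  by rewrite -[X in X <= _]nU expand; exact: (ideal_normD hJ).
rewrite lerD2l.
have j1 : J (it *: (P \o (W \o E2))) by exact: idealZ.
have j2 : J ((it * it) *: (P \o (W \o Q))) by exact: idealZ.
have h1 : N Z <= N (W \o E2) + t * N (P \o (W \o E2)) + t * (t * N (P \o (W \o Q)))
    + N (E1 \o (W \o V)).
  apply: le_trans (ideal_normD hJ _ jE1) _; first by apply: idealB => //; exact: idealD.
  rewrite lerD2r; apply: le_trans (ideal_normB _ j2) _; first exact: idealD.
  rewrite -scalerA nit; last exact: idealZ.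
  rewrite nit// lerD2r -nit//; exact: (ideal_normD hJ).
apply: le_trans h1 _.
have e3 : t * N (P \o (W \o E2)) <= (t * m) ^+ 2 * N W.
  apply: (@le_trans _ _ (t * m * N (W \o E2))).
    by rewrite -mulrA ler_pM2l.
  apply: le_trans n2; rewrite ler_piMl//; exact: ideal_norm_ge0.
have e4 : t * (t * N (P \o (W \o Q))) <= (t * m) ^+ 2 * N W.
  have -> : (t * m) ^+ 2 * N W = t * (t * (m * (m * N W))) by ring.
  rewrite !ler_pM2l//; apply: le_trans n4 _; by rewrite ler_pM2l.
lra.
Qed.

Lemma norm_dissipative : N W <= N (W + 'i%C *: ((P \o W) - (W \o Q))).
Proof.
have [m m0 hm] := second_order; have W0 := ideal_norm_ge0 jW.
rewrite -/G -subr_le0; apply: le0_small => e e0.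
pose K := 4 * m ^+ 2 * N W + 1.
have K0 : 0 < K by rewrite ltr_wpDl// mulr_ge0// mulr_ge0// sqr_ge0.
(* The three bounds serve convexity ([t <= 1]), the second order estimate ([t * m <= 1]) and the
   error left after division by [t] ([t * K <= e]). *)
pose t := Num.min (Num.min 1 m^-1) (e / K).
have t0 : 0 < t by rewrite !lt_min ltr01 invr_gt0 m0 divr_gt0.
have t1 : t <= 1 by rewrite !ge_min lexx.
have tm : t * m <= 1 by rewrite -ler_pdivlMr// mul1r !ge_min lexx orbT.
have tK : t * K <= e by rewrite -ler_pdivlMr// !ge_min lexx !orbT.
have h := hm t t0 tm.
have conv : N (W + t%:C *: G) <= (1 - t) * N W + t * N (W + G).
  have -> : W + t%:C *: G = (1 - t)%:C *: W + t%:C *: (W + G).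
    by rewrite scalerDr addrA -scalerDl -rmorphD subrK rmorph1 scale1r.
  have jWG := idealD jW jG.
  apply: le_trans (ideal_normD hJ (idealZ _ jW) (idealZ _ jWG)) _.
  by rewrite !ideal_normZr// (gtr0_norm t0) ger0_norm ?subr_ge0.
have : t * (N W - N (W + G)) <= t * (t * (4 * m ^+ 2 * N W)).
  have -> : t * (t * (4 * m ^+ 2 * N W)) = 4 * (t * m) ^+ 2 * N W by ring.
  lra.
rewrite ler_pM2l// => h2; apply: le_trans h2 _; apply: le_trans tK.
by rewrite ler_pM2l// /K lerDl.
Qed.

End dissipative.

End NormIdeal.

(** * The arithmetic-geometric mean inequality *)

Section ArithmeticGeometricMean.
Context {R : realType} {H : hilbertType R}.
Implicit Types (S T U V W X Y : H -> H) (f g : R -> R) (c m t : R).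
Variables (J : set (H -> H)) (N : (H -> H) -> R).
Hypothesis hN : unitarily_invariant_norm J N.

Let hJ : norm_ideal J N. Proof. by case: hN. Qed.

Variables (A B : H -> H).
Hypotheses (hA : positive_op A) (hB : positive_op B).

Definition derivation P Q W : H -> H := (P \o W) - (W \o Q).

Lemma derivation_linear P Q : linear P -> linear (derivation P Q).
Proof.
move=> lP c V W; rewrite /derivation.
have -> : P \o (c *: V + W) = c *: (P \o V) + (P \o W).
  by apply/funext => u /=; rewrite !opE (linear_mapD lP) (linear_mapZ lP).
by rewrite scalerBr addrACA -opprD.
Qed.

Lemma pev_ideal (D : (H -> H) -> H -> H) p W : (forall V, J V -> J (D V)) ->
  J W -> J (pev D p W).
Proof.
move=> jD jW; rewrite /pev; elim/big_ind: _ => [|V V' jV jV'|i _].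
- exact: ideal0 hJ.
- exact: (idealD hN).
- by apply: (idealZ hN); elim: (nat_of_ord i) => [//|n IH]; exact: jD.
Qed.

Section polynomial.
Variables (f g : R -> R) (P Q : H -> H).
Hypotheses (cf : continuous f) (cg : continuous g).
Hypotheses (cP : calc A f P) (cQ : calc B g Q).

Let D := derivation P Q.
Let lP : linear P. Proof. by have [/bounded_opP[]] := cP. Qed.
Let lD : linear D. Proof. exact: derivation_linear. Qed.
Let jD W : J W -> J (D W).
Proof.
move=> jW; apply: (idealB hN).
  by apply: (ideal_compl hN) => //; case: cP.
by apply: (ideal_compr hN) => //; case: cQ.
Qed.

Lemma norm_pev_prod (s : seq R) W : J W ->
  N W <= N (pev D (\prod_(l <- s) (1 + (Complex 0 l) *: 'X)) W).
Proof.
move=> jW; elim: s => [|l s IH]; first by rewrite big_nil pev1.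
rewrite big_cons (pevM lD); apply: le_trans IH _.
set W' := pev D _ W; have jW' : J W' by exact: pev_ideal.
rewrite pevD pev1 pevZ pevX.
have scal (h : R -> R) : continuous h -> continuous (fun x => l * h x + 0).
  by move=> ch x; apply: cvgD; [apply: cvgMl_tmp; exact: ch|exact: cvg_cst].
have cP' := calc_lin l cP (calc_cst A 0); have cQ' := calc_lin l cQ (calc_cst B 0).
have := norm_dissipative hN hA hB (scal _ cf) (scal _ cg) cP' cQ' jW'.
rewrite !rmorph0 !scale0r !addr0.
have lW' := ideal_linear_op hN jW'.
have -> // : 'i%C *: (((l%:C *: P) \o W') - (W' \o (l%:C *: Q))) = (Complex 0 l) *: D W'.
have -> : Complex 0 l = 'i%C * l%:C :> R[i].
  by apply/eqP; rewrite eq_complex /=; apply/andP; split; apply/eqP; ring.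
rewrite -scalerA; congr (_ *: _); apply/funext => u.
by rewrite /D /derivation !opE /= !opE (linear_mapZ lW') scalerBr.
Qed.

Lemma norm_sum_iter n W : (0 < n)%N -> J W ->
  2 * N W <= N (iter n (fun V => V + D V) W + iter n (fun V => V - D V) W).
Proof.
move=> n0 jW; have [s hs] := @sum_pow_factor R n n0.
have pevXn (p : {poly R[i]}) : pev D (p ^+ n) W = iter n (pev D p) W.
  elim: (n) => [|k IH]; first by rewrite expr0 pev1.
  by rewrite exprS (pevM lD) IH.
have e1 : pev D (1 + 'X) = fun V => V + D V.
  by apply/funext => V; rewrite pevD pev1 pevX.
have e2 : pev D (1 - 'X) = fun V => V - D V.
  by apply/funext => V; rewrite -scaleN1r pevD pev1 pevZ pevX scaleN1r.
have := congr1 (fun p => pev D p W) hs.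
rewrite pevD !pevXn e1 e2 mul_polyC pevZ => ->.
have -> : (2 : R[i]) = (2 : R)%:C by rewrite rmorph_nat.
rewrite (ideal_normZr hN); last exact: pev_ideal.
by rewrite ger0_norm// ler_pM2l//; exact: norm_pev_prod.
Qed.

End polynomial.

Section euler.
Variables (f g : R -> R) (P Q U V : H -> H) (m : R).
Hypotheses (cf : continuous f) (cg : continuous g).
Hypotheses (cP : calc A f P) (cQ : calc B g Q).
Hypotheses (cU : calc A (fun x => expR (f x)) U).
Hypotheses (cV : calc B (fun x => expR (- g x)) V).
Hypotheses (m0 : 0 < m) (m1 : m <= 1 / 2).
Hypotheses (fm : forall x, rspec A x -> `|f x| <= m).
Hypotheses (gm : forall x, rspec B x -> `|g x| <= m).

Let D := derivation P Q.
(** [X] is [1 + D] and [Y] is [exp D], known in closed form: left and right multiplications commute,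
    so [exp D] maps [W] to [exp(P) W exp(-Q)]. *)
Let X W : H -> H := W + D W.
Let Y W : H -> H := U \o (W \o V).

Let bP : bounded_op P. Proof. by case: cP. Qed.
Let bQ : bounded_op Q. Proof. by case: cQ. Qed.
Let bU : bounded_op U. Proof. by case: cU. Qed.
Let bV : bounded_op V. Proof. by case: cV. Qed.
Let lP : linear P. Proof. by have [/bounded_opP[]] := cP. Qed.

Let jX W : J W -> J (X W).
Proof.
move=> jW; apply: (idealD hN) => //; apply: (idealB hN).
  exact: (ideal_compl hN).
exact: (ideal_compr hN).
Qed.

Let jY W : J W -> J (Y W).
Proof. by move=> jW; apply: (ideal_compl hN) => //; exact: (ideal_compr hN). Qed.

Let cexp (h : R -> R) : continuous h -> continuous (fun x : R => expR (h x)).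
Proof.
by move=> ch x; apply: continuous_comp; [exact: ch|exact: continuous_expR].
Qed.

Let copp (h : R -> R) : continuous h -> continuous (fun x : R => - h x).
Proof. by move=> ch x; apply: cvgN; exact: ch. Qed.

Let caff c (h h' : R -> R) : continuous h -> continuous h' -> continuous (fun x : R => c * h x + h' x).
Proof.
by move=> ch ch' x; apply: cvgD; [apply: cvgMl_tmp; exact: ch|exact: ch'].
Qed.

Let exp_le (x : R) : `|x| <= m -> `|expR x| <= expR m.
Proof.
move=> xm; rewrite gtr0_norm ?expR_gt0// ler_expR.
by rewrite (le_trans (ler_norm _)).
Qed.

Let normY W : J W -> N (Y W) <= expR (2 * m) * N W.
Proof.
move=> jW; have jWV := ideal_compr hN bV jW.
have fe x : rspec A x -> `|expR (f x)| <= expR m by move=> /fm /exp_le.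
have ge x : rspec B x -> `|expR (- g x)| <= expR m.
  by move=> /gm gx; apply: exp_le; rewrite normrN.
apply: le_trans (norm_mull hN hA (cexp cf) cU (expR_gt0 m) fe jWV) _.
have -> : expR (2 * m) = expR m * expR m by rewrite -expRD; congr expR; ring.
rewrite -mulrA ler_pM2l ?expR_gt0//.
exact: (norm_mulr hN hB (cexp (copp cg)) cV (expR_gt0 m) ge jW).
Qed.

Let normX W : J W -> N (X W) <= expR (2 * m) * N W.
Proof.
move=> jW; have W0 := ideal_norm_ge0 hN jW.
have jPW := ideal_compl hN bP jW; have jWQ := ideal_compr hN bQ jW.
apply: (@le_trans _ _ ((1 + 2 * m) * N W)); last first.
  by rewrite ler_wpM2r// expR_ge1Dx.
have h1 := norm_mull hN hA cf cP m0 fm jW.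
have h2 := norm_mulr hN hB cg cQ m0 gm jW.
have := ideal_normD hJ jW (idealB hN jPW jWQ).
have := ideal_normB hN jPW jWQ.
rewrite -/(derivation P Q W) -/D -/(X W); lra.
Qed.

(** The difference is split into three terms, each with a factor of second order or two factors of
    first order. They contribute 4, 2 and 2 to the constant 8; the 4 includes the bound 2 for
    multiplication by [V]. *)
Let normXY W : J W -> N (X W - Y W) <= 8 * m ^+ 2 * N W.
Proof.
move=> jW; have W0 := ideal_norm_ge0 hN jW.
have lW := ideal_linear_op hN jW.
pose S := (-1)%:C *: P + ((-1)%:C *: (1%:C *: id) + U).
pose T := 1%:C *: Q + ((-1)%:C *: (1%:C *: id) + V).
pose T1 := (-1)%:C *: (1%:C *: id) + V.
have cS : calc A _ S := calc_lin (-1) cP (calc_lin (-1) (calc_cst A 1) cU).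
have cT : calc B _ T := calc_lin 1 cQ (calc_lin (-1) (calc_cst B 1) cV).
have cT1 : calc B _ T1 := calc_lin (-1) (calc_cst B 1) cV.
have c1 : continuous (fun _ : R => 1 : R) by move=> x; exact: cvg_cst.
have ctS := @caff (-1) _ _ cf (@caff (-1) _ _ c1 (cexp cf)).
have ctT := @caff 1 _ _ cg (@caff (-1) _ _ c1 (cexp (copp cg))).
have ctT1 := @caff (-1) _ _ c1 (cexp (copp cg)).
have m2 : 0 < 2 * m ^+ 2 by rewrite mulr_gt0// exprn_gt0.
have mm : 0 < 2 * m by rewrite mulr_gt0.
have sq x : `|x| <= m -> 2 * x ^+ 2 <= 2 * m ^+ 2.
  move=> xm; rewrite ler_pM2l// -(real_normK (num_real x)).
  by rewrite ler_pXn2r ?nnegrE ?(ltW m0).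
have bS x : rspec A x -> `|-1 * f x + (-1 * 1 + expR (f x))| <= 2 * m ^+ 2.
  move=> /fm xm; apply: le_trans (sq _ xm).
  have -> : -1 * f x + (-1 * 1 + expR (f x)) = expR (f x) - 1 - f x by ring.
  by apply: expR_approx2; exact: le_trans m1.
have bT x : rspec B x -> `|1 * g x + (-1 * 1 + expR (- g x))| <= 2 * m ^+ 2.
  move=> /gm xm; have xm' : `|- g x| <= m by rewrite normrN.
  apply: le_trans (sq _ xm').
  have -> : 1 * g x + (-1 * 1 + expR (- g x)) = expR (- g x) - 1 - (- g x) by ring.
  by apply: expR_approx2; exact: le_trans m1.
have bT1 x : rspec B x -> `|-1 * 1 + expR (- g x)| <= 2 * m.
  move=> /gm xm; have xm' : `|- g x| <= m by rewrite normrN.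
  have -> : -1 * 1 + expR (- g x) = expR (- g x) - 1 by ring.
  apply: (le_trans (expR_approx1 (le_trans xm' m1))).
  by rewrite ler_pM2l.
have bV2 x : rspec B x -> `|expR (- g x)| <= 2.
  move=> /gm xm; have xm' : `|- g x| <= m by rewrite normrN.
  have := ler_normD (expR (- g x) - 1) 1; rewrite subrK normr1.
  have e1 := expR_approx1 (le_trans xm' m1).
  have mm1 : 2 * `|- g x| <= 1 by rewrite mulrC -ler_pdivlMr// (le_trans xm').
  by move=> /le_trans; apply; rewrite lerD2r (le_trans e1).
have [bSo _] := cS; have [bTo _] := cT; have [bT1o _] := cT1.
have jWV := ideal_compr hN bV jW; have jSWV := ideal_compl hN bSo jWV.
have jWT := ideal_compr hN bTo jW; have jWT1 := ideal_compr hN bT1o jW.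
have jPWT1 := ideal_compl hN bP jWT1.
(* [S = U - 1 - P], [T = V - 1 + Q] and [T1 = V - 1]. *)
have -> : X W - Y W = - ((S \o (W \o V)) + (W \o T) + (P \o (W \o T1))).
  have T1u u : W (T1 u) = W (V u) - W u.
    by rewrite /T1 rmorphN1 rmorph1 scaleN1r scale1r !opE addrC (linear_mapB lW).
  have Tu u : W (T u) = W (Q u) + (W (V u) - W u).
    by rewrite /T opE (linear_mapD lW) rmorph1 scale1r; congr (_ + _); exact: T1u.
  have Su u : S u = - P u + (U u - u).
    by rewrite /S !opE rmorphN1 rmorph1 !scaleN1r scale1r [- u + _]addrC.
  apply/funext => u; rewrite /X /Y /D /derivation !opE /= Su Tu T1u (linear_mapB lP).
  move: (W u) (W (V u)) (P (W u)) (W (Q u)) (U (W (V u))) (P (W (V u))) => w wv pw wq uwv pwv.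
  rewrite [X in _ = - X](AC ((1*2)*(1*2)*2) (((1*7)*(3*5))*((2*4)*(6*8)))).
  rewrite /= !addNr !add0r !opprD !opprK.
  by rewrite (AC ((1*2)*1) ((4*3)*(1*2))).
rewrite (ideal_normN hN); last by apply: (idealD hN) => //; exact: (idealD hN).
apply: le_trans (ideal_normD hJ (idealD hN jSWV jWT) jPWT1) _.
apply: le_trans (lerD (ideal_normD hJ jSWV jWT) (lexx _)) _.
have h1 := norm_mull hN hA ctS cS m2 bS jWV.
have h2 := norm_mulr hN hB (cexp (copp cg)) cV (ltr0n _ 2) bV2 jW.
have h3 := norm_mulr hN hB ctT cT m2 bT jW.
have h4 := norm_mull hN hA cf cP m0 fm jWT1.
have h5 := norm_mulr hN hB ctT1 cT1 mm bT1 jW.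
have h6 : 2 * m ^+ 2 * N (W \o V) <= 2 * m ^+ 2 * (2 * N W) by rewrite ler_pM2l.
have h7 : m * N (W \o T1) <= m * (2 * m * N W) by rewrite ler_pM2l.
lra.
Qed.

(** Telescoping: the difference of the powers of order [n + 1] is [X] applied to the difference of
    order [n], plus [X - Y] applied to the power of [Y]. Both maps increase the norm at most by the
    factor [K]. *)
Lemma euler_bound n W : J W ->
  N (iter n X W - iter n Y W) <= n%:R * (8 * m ^+ 2) * expR (2 * m) ^+ n * N W.
Proof.
move=> jW; set K := expR (2 * m).
have K1 : 1 <= K by rewrite /K -expR0 ler_expR mulr_ge0// ltW.
have K0 : 0 < K by exact: lt_le_trans K1.
have W0 := ideal_norm_ge0 hN jW.
have jXn k : J (iter k X W) by elim: k => [//|k IH]; exact: jX.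
have jYn k : J (iter k Y W) by elim: k => [//|k IH]; exact: jY.
have nY k : N (iter k Y W) <= K ^+ k * N W.
  elim: k => [|k IH]; first by rewrite expr0 mul1r.
  apply: le_trans (normY (jYn k)) _.
  by rewrite exprS -mulrA ler_pM2l.
elim: n => [|n IH].
  by rewrite subrr !mul0r; have := ideal_normZr hN 0 (ideal0 hJ); rewrite scaler0 normr0 mul0r => ->.
have lX V' W' : X V' - X W' = X (V' - W').
  rewrite /X /D.
  by rewrite (linear_mapB (derivation_linear Q lP)) opprD addrACA.
rewrite !iterS.
have -> : X (iter n X W) - Y (iter n Y W) =
    X (iter n X W - iter n Y W) + (X (iter n Y W) - Y (iter n Y W)).
  by rewrite -lX subrKA.
have jd := idealB hN (jXn n) (jYn n).
apply: le_trans (ideal_normD hJ (jX jd) (idealB hN (jX (jYn n)) (jY (jYn n)))) _.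
have h1 := normX jd; have h2 := normXY (jYn n).
rewrite -/K in h1.
have m2 : 0 <= 8 * m ^+ 2 by rewrite mulr_ge0// sqr_ge0.
have h3 : K * N (iter n X W - iter n Y W) <=
    K * (n%:R * (8 * m ^+ 2) * K ^+ n * N W) by rewrite ler_pM2l.
(* One factor [K >= 1] is given away, so that both terms carry [K ^+ n.+1]. *)
have h4 : 8 * m ^+ 2 * N (iter n Y W) <= 8 * m ^+ 2 * (K * (K ^+ n * N W)).
  apply: ler_wpM2l => //; apply: le_trans (nY n) _.
  by rewrite ler_peMl// mulr_ge0// exprn_ge0// ltW.
apply: (le_trans (lerD (le_trans h1 h3) (le_trans h2 h4))).
rewrite -[n.+1]addn1 natrD addn1 (exprS K) le_eqVlt; apply/orP; left; apply/eqP; ring.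
Qed.

End euler.

End ArithmeticGeometricMean.

(** * Passage to the limit and the operator arithmetic-geometric mean inequality *)

Section ArithmeticGeometricMeanLimit.
Context {R : realType} {H : hilbertType R}.
Implicit Types (S T U V W X Y : H -> H) (f g : R -> R) (c m t : R).
Variables (J : set (H -> H)) (N : (H -> H) -> R).
Hypothesis hN : unitarily_invariant_norm J N.

Let hJ : norm_ideal J N. Proof. by case: hN. Qed.

Lemma calc_iter A f T n : positive_op A -> calc A f T ->
  calc A (fun x => f x ^+ n) (iter n T).
Proof.
move=> hA cT; elim: n => [|n IH].
  by have := @calc_cst _ _ A 1; rewrite rmorph1 scale1r; apply: calc_ext => x _; rewrite expr0.
by apply: calc_ext (calcM hA cT IH) => x _; rewrite exprS.
Qed.

Variables (A B : H -> H).
Hypotheses (hA : positive_op A) (hB : positive_op B).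

Let cexp (h : R -> R) : continuous h -> continuous (fun x : R => expR (h x)).
Proof.
by move=> ch x; apply: continuous_comp; [exact: ch|exact: continuous_expR].
Qed.

Let copp (h : R -> R) : continuous h -> continuous (fun x : R => - h x).
Proof. by move=> ch x; apply: cvgN; exact: ch. Qed.

Let caff c (h h' : R -> R) : continuous h -> continuous h' ->
  continuous (fun x : R => c * h x + h' x).
Proof.
by move=> ch ch' x; apply: cvgD; [apply: cvgMl_tmp; exact: ch|exact: ch'].
Qed.

Let ccst c : continuous (fun _ : R => c).
Proof. by move=> x; exact: cvg_cst. Qed.

(** Convergence of [(1 + D / n)^n W] to [exp(D) W = E W F] with a rate: [euler_bound] with [m / n]
    in place of [m] gives the error [K / n], where [K = 8 m^2 exp(2 m) N W]. The two thresholds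
    ensure [m / n <= 1 / 2] and [K / n <= e]. *)
Lemma euler_limit f g E F W e : continuous f -> continuous g ->
  calc A (fun x => expR (f x)) E -> calc B (fun x => expR (- g x)) F -> J W -> 0 < e ->
  exists n0, forall n P Q, (n0 <= n)%N -> (0 < n)%N ->
    calc A (fun x => n%:R^-1 * f x + 0) P -> calc B (fun x => n%:R^-1 * g x + 0) Q ->
    N (iter n (fun V => V + derivation P Q V) W - (E \o (W \o F))) <= e.
Proof.
move=> cf cg cE cF jW e0.
have [mf f0 fm] := calc_bounded hA (calcP hA cf).
have [mg g0 gm] := calc_bounded hB (calcP hB cg).
pose m := mf + mg + 1; have m0 : 0 < m by rewrite /m; lra.
have W0 := ideal_norm_ge0 hN jW.
pose K := 8 * m ^+ 2 * expR (2 * m) * N W.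
have K0 : 0 <= K by rewrite /K mulr_ge0// mulr_ge0 ?expR_ge0// mulr_ge0// sqr_ge0.
exists (maxn (Num.truncn (2 * m)).+1 (Num.truncn (K / e)).+1) => n P Q.
rewrite geq_max => /andP[n1 n2] n0 cP cQ.
have nR : 0 < n%:R :> R by rewrite ltr0n.
have n1' : 2 * m <= n%:R by rewrite ltW// (lt_le_trans (truncnS_gt _))// ler_nat.
have n2' : K / e <= n%:R by rewrite ltW// (lt_le_trans (truncnS_gt _))// ler_nat.
have mn0 : 0 < m / n%:R by rewrite divr_gt0.
have mn1 : m / n%:R <= 1 / 2 by rewrite ler_pdivrMr//; lra.
have fn x : rspec A x -> `|n%:R^-1 * f x + 0| <= m / n%:R.
  move=> /fm fx; rewrite addr0 normrM mulrC (@gtr0_norm _ n%:R^-1) ?invr_gt0//.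
  by rewrite ler_pM2r ?invr_gt0// /m; lra.
have gn x : rspec B x -> `|n%:R^-1 * g x + 0| <= m / n%:R.
  move=> /gm gx; rewrite addr0 normrM mulrC (@gtr0_norm _ n%:R^-1) ?invr_gt0//.
  by rewrite ler_pM2r ?invr_gt0// /m; lra.
have cfn := @caff n%:R^-1 _ _ cf (@ccst 0).
have cgn := @caff n%:R^-1 _ _ cg (@ccst 0).
have [U cU] := calc_exists hA (cexp cfn).
have [V cV] := calc_exists hB (cexp (copp cgn)).
have := euler_bound hN hA hB cfn cgn cP cQ cU cV mn0 mn1 fn gn n jW.
have UE : iter n U = E.
  apply: (calc_unique hA (calc_iter n hA cU)); apply: calc_ext cE => x _.
  by rewrite -expRM_natl; congr expR; field; rewrite gt_eqF.
have VF : iter n V = F.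
  apply: (calc_unique hB (calc_iter n hB cV)); apply: calc_ext cF => x _.
  by rewrite -expRM_natl; congr expR; field; rewrite gt_eqF.
have -> : iter n (fun W => U \o (W \o V)) W = E \o (W \o F).
  rewrite -UE -VF; clear; elim: n => [//|n IH].
  by rewrite [LHS]iterS IH; apply/funext => u; rewrite /= -iterSr.
move=> /le_trans; apply.
have -> : n%:R * (8 * (m / n%:R) ^+ 2) * expR (2 * (m / n%:R)) ^+ n * N W = K / n%:R.
  have -> : expR (2 * (m / n%:R)) ^+ n = expR (2 * m).
    by rewrite -expRM_natl; congr expR; field; rewrite gt_eqF.
  by rewrite /K; field; rewrite gt_eqF.
by rewrite ler_pdivrMr// mulrC -ler_pdivrMr.
Qed.

(** Here [E W F] is [exp(D) W] and [E' W F'] is [exp(-D) W]. The inequality is the limit of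
    [norm_sum_iter] for [D / n], with one [n] large enough for both signs. *)
Lemma norm_cosh f g E F E' F' W : continuous f -> continuous g ->
  calc A (fun x => expR (f x)) E -> calc B (fun x => expR (- g x)) F ->
  calc A (fun x => expR (- f x)) E' -> calc B (fun x => expR (g x)) F' -> J W ->
  2 * N W <= N ((E \o (W \o F)) + (E' \o (W \o F'))).
Proof.
move=> cf cg cE cF cE' cF' jW; rewrite -subr_le0; apply: le0_small => e e0.
have e2 : 0 < e / 2 by lra.
have cF'' : calc B (fun x => expR (- - g x)) F'.
  by apply: calc_ext cF' => x _; rewrite opprK.
have [n1 h1] := euler_limit cf cg cE cF jW e2.
have [n2 h2] := euler_limit (copp cf) (copp cg) cE' cF'' jW e2.
pose n := maxn 1 (maxn n1 n2).
have n0 : (0 < n)%N by rewrite leq_max.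
have nn1 : (n1 <= n)%N by rewrite /n !leq_max leqnn orbT.
have nn2 : (n2 <= n)%N by rewrite /n !leq_max leqnn !orbT.
have cfn := @caff n%:R^-1 _ _ cf (@ccst 0).
have cgn := @caff n%:R^-1 _ _ cg (@ccst 0).
have [P cP] := calc_exists hA cfn; have [Q cQ] := calc_exists hB cgn.
have [bP _] := cP; have [bQ _] := cQ.
have cNP := calc_lin (-1) cP (calc_cst A 0); have cNQ := calc_lin (-1) cQ (calc_cst B 0).
rewrite rmorph0 scale0r addr0 rmorphN1 scaleN1r in cNP.
rewrite rmorph0 scale0r addr0 rmorphN1 scaleN1r in cNQ.
have cNP' : calc A (fun x => n%:R^-1 * - f x + 0) (- P).
  by apply: calc_ext cNP => x _; ring.
have cNQ' : calc B (fun x => n%:R^-1 * - g x + 0) (- Q).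
  by apply: calc_ext cNQ => x _; ring.
have {}h1 := h1 n P Q nn1 n0 cP cQ; have {}h2 := h2 n _ _ nn2 n0 cNP' cNQ'.
have jD S T V : bounded_op S -> bounded_op T -> J V -> J (V + derivation S T V).
  move=> bS bT jV; apply: (idealD hN) => //; apply: (idealB hN).
    exact: (ideal_compl hN).
  exact: (ideal_compr hN).
have jI S T k : bounded_op S -> bounded_op T ->
    J (iter k (fun V => V + derivation S T V) W).
  by move=> bS bT; elim: k => [//|k IH]; exact: jD.
have bNP : bounded_op (- P) by case: cNP'.
have bNQ : bounded_op (- Q) by case: cNQ'.
(* The iterates belong to [J], hence are linear, which lets the sign of [Q] pass through them. *)
have iterN k : iter k (fun V => V - derivation P Q V) W =
    iter k (fun V => V + derivation (- P) (- Q) V) W.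
  elim: k => [//|k IH]; rewrite !iterS IH; congr (_ + _).
  have lV := ideal_linear_op hN (jI _ _ k bNP bNQ).
  apply/funext => u; rewrite /derivation !opE /= !opE (linear_mapN lV).
  by rewrite opprB addrC opprK.
have := norm_sum_iter hN hA hB cfn cgn cP cQ n0 jW; rewrite iterN.
set X1 := iter _ _ _ in h1 *; set X2 := iter _ _ _ in h2 *.
have [bE _] := cE; have [bF _] := cF; have [bE' _] := cE'; have [bF' _] := cF'.
have jX1 : J X1 by exact: jI.
have jX2 : J X2 by exact: jI.
have jY1 : J (E \o (W \o F)) by apply: (ideal_compl hN) => //; exact: (ideal_compr hN).
have jY2 : J (E' \o (W \o F')) by apply: (ideal_compl hN) => //; exact: (ideal_compr hN).
move: (E \o (W \o F)) (E' \o (W \o F')) jY1 jY2 h1 h2 => Y1 Y2 jY1 jY2 h1 h2.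
have := ideal_norm_tri hN (idealD hN jX1 jX2) (idealD hN jY1 jY2).
have -> : X1 + X2 - (Y1 + Y2) = (X1 - Y1) + (X2 - Y2) by rewrite opprD addrACA.
have := ideal_normD hJ (idealB hN jX1 jY1) (idealB hN jX2 jY2).
lra.
Qed.

(** Positivity on the whole line makes [ln (f x)] and [ln (g x)] continuous, as the exponential form
    of [P] and [Q] demands; [E'] and [F] are then the inverses of [P] and [Q]. *)
Lemma norm_am_gm_pos f g P Q Y : continuous f -> continuous g ->
  (forall x, 0 < f x) -> (forall x, 0 < g x) -> calc A f P -> calc B g Q -> J Y ->
  2 * N (P \o (Y \o Q)) <= N ((P \o (P \o Y)) + (Y \o (Q \o Q))).
Proof.
move=> cf cg f0 g0 cP cQ jY.
have cln (h : R -> R) : continuous h -> (forall x, 0 < h x) -> continuous (fun x => ln (h x)).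
  move=> ch h0 x; apply: continuous_comp; first exact: ch.
  exact: continuous_ln.
have cE : calc A (fun x => expR (ln (f x))) P.
  by apply: calc_ext cP => x _; rewrite lnK// posrE.
have cF' : calc B (fun x => expR (ln (g x))) Q.
  by apply: calc_ext cQ => x _; rewrite lnK// posrE.
have [E' cE'] := calc_exists hA (cexp (copp (cln _ cf f0))).
have [F cF] := calc_exists hB (cexp (copp (cln _ cg g0))).
have [bP _] := cP; have [bQ _] := cQ.
have jW : J (P \o (Y \o Q)) by apply: (ideal_compl hN) => //; exact: (ideal_compr hN).
have EP : E' \o P = id.
  apply: (calc_unique hA (calcM hA cE' cE)).
  have := @calc_cst _ _ A 1; rewrite rmorph1 scale1r; apply: calc_ext => x _.
  by rewrite -expRD addNr expR0.
have QF : Q \o F = id.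
  apply: (calc_unique hB (calcM hB cF' cF)).
  have := @calc_cst _ _ B 1; rewrite rmorph1 scale1r; apply: calc_ext => x _.
  by rewrite -expRD subrr expR0.
(* With [D = L_(ln f(A)) - R_(ln g(B))], [2 cosh D] maps [P Y Q] to
   [P^2 Y + Y Q^2]. *)
have := norm_cosh (cln _ cf f0) (cln _ cg g0) cE cF cE' cF' jW.
have -> : P \o ((P \o (Y \o Q)) \o F) = P \o (P \o (Y \o (Q \o F))) by [].
have -> : E' \o ((P \o (Y \o Q)) \o Q) = (E' \o P) \o (Y \o (Q \o Q)) by [].
by rewrite QF EP.
Qed.

(* The general case follows by replacing [P] and [Q] by the invertible
   [P + e] and [Q + e]. *)
Lemma norm_am_gm f g P Q Y : continuous f -> continuous g ->
  (forall x, 0 <= f x) -> (forall x, 0 <= g x) -> calc A f P -> calc B g Q -> J Y ->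
  2 * N (P \o (Y \o Q)) <= N ((P \o (P \o Y)) + (Y \o (Q \o Q))).
Proof.
move=> cf cg f0 g0 cP cQ jY.
have [bP _] := cP; have [bQ _] := cQ.
have [lP _] := (bounded_opP _).1 bP; have [lQ _] := (bounded_opP _).1 bQ.
have lY := ideal_linear_op hN jY.
have jYQ := ideal_compr hN bQ jY; have jPY := ideal_compl hN bP jY.
have jPYQ := ideal_compl hN bP jYQ.
have jS : J ((P \o (P \o Y)) + (Y \o (Q \o Q))).
  apply: (idealD hN); first exact: (ideal_compl hN).
  by apply: (ideal_compr hN) => //; exact: bounded_comp.
pose Z := (P \o Y) + (Y \o Q); have jZ : J Z by exact: (idealD hN).
have Y0 := ideal_norm_ge0 hN jY; have Z0 := ideal_norm_ge0 hN jZ.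
(* The shift by [e <= 1] changes [2 * N (P Y Q)] and the right-hand side by at most
   [2 e (N Z + N Y)] each, so the total error is below [e * K]. *)
pose K := 4 * N Z + 4 * N Y + 1; have K0 : 0 < K by rewrite /K; lra.
rewrite -subr_le0; apply: le0_small => d d0.
pose e := Num.min 1 (d / K).
have e0 : 0 < e by rewrite lt_min ltr01 divr_gt0.
have e1 : e <= 1 by rewrite ge_min lexx.
have eK : e * K <= d by rewrite -ler_pdivlMr// ge_min lexx orbT.
have cPe := calc_lin e (calc_cst A 1) cP; have cQe := calc_lin e (calc_cst B 1) cQ.
rewrite rmorph1 scale1r in cPe; rewrite rmorph1 scale1r in cQe.
have fe x : 0 < e * 1 + f x by rewrite mulr1 ltr_pwDl.
have ge x : 0 < e * 1 + g x by rewrite mulr1 ltr_pwDl.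
have := norm_am_gm_pos (@caff e _ _ (@ccst 1) cf) (@caff e _ _ (@ccst 1) cg) fe ge cPe cQe jY.
set Pe := _ + P; set Qe := _ + Q => h.
pose ec := e%:C.
have eZ V : J V -> N (ec *: V) = e * N V.
  by move=> jV; rewrite (ideal_normZr hN)// gtr0_norm.
have ex1 : Pe \o (Y \o Qe) = (P \o (Y \o Q)) + (ec *: Z + ec *: (ec *: Y)).
  apply/funext => u; rewrite /Pe /Qe /Z !opE /= !opE (linear_mapD lY) (linear_mapZ lY).
  rewrite (linear_mapD lP) (linear_mapZ lP) -/ec !scalerDr.
  move: (P (Y (Q u))) (ec *: (ec *: Y u)) (ec *: P (Y u)) (ec *: Y (Q u)) => a b c c'.
  by rewrite (AC (2*2) (4*((3*2)*1))).
have ex2 : (Pe \o (Pe \o Y)) + (Y \o (Qe \o Qe)) =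
    ((P \o (P \o Y)) + (Y \o (Q \o Q))) +
    ((ec *: Z + ec *: Z) + (ec *: (ec *: Y) + ec *: (ec *: Y))).
  apply/funext => u; rewrite /Pe /Qe /Z !opE /= !opE.
  rewrite !(linear_mapD lP, linear_mapZ lP, linear_mapD lY, linear_mapZ lY).
  rewrite (linear_mapD lQ) (linear_mapZ lQ) !(linear_mapD lY, linear_mapZ lY) -/ec !scalerDr.
  move: (P (P (Y u))) (Y (Q (Q u))) (ec *: (ec *: Y u)) (ec *: P (Y u)) (ec *: Y (Q u)) => a a' b c c'.
  by rewrite (AC ((2*2)*(2*2)) ((4*8)*(((2*6)*(3*7))*(1*5)))).
have jZe : J (ec *: Z) by exact: (idealZ hN).
have jYe : J (ec *: (ec *: Y)) by do 2 apply: (idealZ hN).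
have nYe : N (ec *: (ec *: Y)) = e * (e * N Y) by rewrite !eZ//; exact: (idealZ hN).
have ee : e * (e * N Y) <= e * N Y by rewrite ler_pM2l// ler_piMl.
have b1 : N (P \o (Y \o Q)) <= N (Pe \o (Y \o Qe)) + (e * N Z + e * N Y).
  rewrite (_ : P \o (Y \o Q) = Pe \o (Y \o Qe) - (ec *: Z + ec *: (ec *: Y))); last first.
    by rewrite ex1 addrK.
  have je : J (Pe \o (Y \o Qe)).
    by rewrite ex1; apply: (idealD hN) => //; exact: (idealD hN).
  apply: le_trans (ideal_normB hN je (idealD hN jZe jYe)) _.
  rewrite lerD2l; apply: le_trans (ideal_normD hJ jZe jYe) _.
  by rewrite eZ// nYe lerD2l.
have b2 : N ((Pe \o (Pe \o Y)) + (Y \o (Qe \o Qe))) <=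
    N ((P \o (P \o Y)) + (Y \o (Q \o Q))) + (2 * (e * N Z) + 2 * (e * N Y)).
  rewrite ex2; apply: le_trans (ideal_normD hJ jS _) _.
    by apply: (idealD hN); exact: (idealD hN).
  rewrite lerD2l; apply: le_trans (ideal_normD hJ (idealD hN jZe jZe) (idealD hN jYe jYe)) _.
  have := ideal_normD hJ jZe jZe; have := ideal_normD hJ jYe jYe.
  rewrite nYe (eZ _ jZ); lra.
have := eK; rewrite /K; nra.
Qed.

End ArithmeticGeometricMeanLimit.

(** * Powers of positive operators and the Heinz function *)

Section Powers.
Context {R : realType}.
Implicit Types (x s t : R).

(* [powR] itself is discontinuous at [0]: it is [1] at negative reals. *)
Definition abs_powR s x := `|x| `^ s.

Lemma abs_powR_ge0 s x : 0 <= abs_powR s x. Proof. exact: powR_ge0. Qed.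

Lemma abs_powR_continuous s : 0 <= s -> continuous (abs_powR s).
Proof.
rewrite le_eqVlt => /predU1P[<-|s0] x.
  rewrite (_ : abs_powR 0 = fun=> 1); first exact: cvg_cst.
  by apply/funext => y; rewrite /abs_powR powRr0.
have [->|x0] := eqVneq x 0.
  rewrite /continuous_at {2}/abs_powR normr0 powR0 ?gt_eqF//.
  apply/cvgrPdist_lt => e e0.
  have d0 : 0 < e `^ s^-1 by exact: powR_gt0.
  have hd : \forall y \near (0 : R), `|0 - y| < e `^ s^-1.
    exact: (nbhsx_ballx (0 : R) _ d0).
  apply: filterS hd => y; rewrite !sub0r !normrN => yd.
  rewrite ger0_norm ?abs_powR_ge0// /abs_powR.
  have -> : e = (e `^ s^-1) `^ s by rewrite -powRrM mulVf ?gt_eqF// powRr1// ltW.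
  by rewrite gt0_ltr_powR// ?nnegrE// ltW.
have x1 : 0 < `|x| by rewrite normr_gt0.
apply: (@cvg_trans _ (expR (s * ln `|y|) @[y --> x])).
  apply: near_eq_cvg; near=> y.
  rewrite /abs_powR /powR gt_eqF// normr_gt0.
  by near: y; apply: (cvgr_neq0 x) => //; exact: cvg_id.
rewrite /continuous_at /abs_powR /powR gt_eqF//.
have cn : `|y| @[y --> x] --> `|x| by apply: cvg_norm; exact: cvg_id.
have cl : (ln `|y|) @[y --> x] --> ln `|x|.
  exact: (@cvg_comp _ _ _ (fun y : R => `|y|) (@ln R) _ _ _ cn (continuous_ln x1)).
have cs : s * ln `|y| @[y --> x] --> s * ln `|x| by exact: cvgMl_tmp.
exact: (@cvg_comp _ _ _ (fun y : R => s * ln `|y|) (@expR R) _ _ _ cs (@continuous_expR _ _)).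
Unshelve. all: by end_near. Qed.

End Powers.

Section OperatorPowers.
Context {R : realType} {H : hilbertType R}.
Implicit Types (s t : R).
Variable A : H -> H.
Hypothesis hA : positive_op A.

(** On the nonnegative spectrum the continuous function [abs_powR s] agrees with the power defining
    [op_pow]; uniqueness of the calculus identifies the two operators. *)
Lemma op_pow_calc s : 0 <= s -> calc A (abs_powR s) (op_pow A s).
Proof.
move=> s0; have cs := calcP hA (abs_powR_continuous s0).
have cs' : calc A (fun x => x `^ s) (op_fun (abs_powR s) A).
  by apply: calc_ext cs => x /(rspec_ge0 hA) x0; rewrite /abs_powR ger0_norm.
by rewrite /op_pow (calc_op_fun hA cs').
Qed.

Lemma op_pow_bounded s : 0 <= s -> bounded_op (op_pow A s).
Proof. by move=> /op_pow_calc[]. Qed.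

Lemma op_pow_linear s : 0 <= s -> linear (op_pow A s).
Proof. by move=> /op_pow_bounded/bounded_opP[]. Qed.

Lemma op_powD s t u : 0 <= s -> 0 <= t ->
  op_pow A s (op_pow A t u) = op_pow A (s + t) u.
Proof.
move=> s0 t0; have st := addr_ge0 s0 t0.
have := calcM hA (op_pow_calc s0) (op_pow_calc t0) => c1.
suff /(calc_unique hA c1) <- : calc A (fun x => abs_powR s x * abs_powR t x) (op_pow A (s + t)) by [].
apply: calc_ext (op_pow_calc st) => x _; rewrite /abs_powR.
have [st0|stN] := eqVneq (s + t) 0; last by rewrite powRD// (negPf stN).
have -> : s = 0 by lra.
have -> : t = 0 by lra.
by rewrite addr0 !powRr0 mulr1.
Qed.

Lemma op_pow1 : op_pow A 1 = A.
Proof.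
apply: (calc_unique hA (op_pow_calc ler01)).
apply: calc_ext (@calc_id _ _ _ hA) => x /(rspec_ge0 hA) x0.
by rewrite /abs_powR powRr1 ?ger0_norm.
Qed.

Lemma abs_powR_rspec_bounded : exists2 c, 0 < c &
  forall s, 0 <= s <= 2 -> forall x, rspec A x -> `|abs_powR s x| <= c.
Proof.
have [M M0 hM] := rspec_bounded hA.
(* The base [1 + M] is at least 1, so its powers increase with the exponent and one constant serves
   all [s] in [[0, 2]]. *)
exists ((1 + M) `^ 2); first by apply: powR_gt0; rewrite addr_gt0.
move=> s /andP[s0 s2] x /hM /andP[x0 xM].
rewrite ger0_norm ?abs_powR_ge0// /abs_powR (ger0_norm x0).
have M1 : 1 <= 1 + M by rewrite lerDl ltW.
apply: (@le_trans _ _ ((1 + M) `^ s)); last exact: ler_powR.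
by apply: ge0_ler_powR; rewrite ?nnegrE//; lra.
Qed.

End OperatorPowers.

Section Heinz.
Context {R : realType} {H : hilbertType R}.
Variables (J : set (H -> H)) (N : (H -> H) -> R).
Hypothesis hN : unitarily_invariant_norm J N.
Let hJ : norm_ideal J N. Proof. by case: hN. Qed.
Variables (A B X : H -> H).
Hypotheses (hA : positive_op A) (hB : positive_op B) (jX : J X).

Let h := heinz_norm N A B X.

Let bpA s (s0 : 0 <= s) := op_pow_bounded hA s0.
Let bpB s (s0 : 0 <= s) := op_pow_bounded hB s0.

Let jpow s t : 0 <= s -> 0 <= t -> J (op_pow A s \o X \o op_pow B t).
Proof.
move=> s0 t0; apply: (ideal_compr hN); first exact: bpB.
by apply: (ideal_compl hN) => //; exact: bpA.
Qed.

Lemma heinz_sym s : h (2 - s) = h s.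
Proof. by rewrite /h /heinz_norm subKr addrC. Qed.

Lemma heinz_bounded : exists C, forall s, 0 <= s <= 2 -> 0 <= h s <= C.
Proof.
have [a a0 ha] := abs_powR_rspec_bounded hA.
have [b b0 hb] := abs_powR_rspec_bounded hB.
have term s t : 0 <= s <= 2 -> 0 <= t <= 2 ->
    N (op_pow A s \o X \o op_pow B t) <= b * (a * N X).
  move=> s02 t02; have [s0 _] := andP s02; have [t0 _] := andP t02.
  have jAX := ideal_compl hN (bpA s0) jX.
  apply: le_trans (norm_mulr hN hB (abs_powR_continuous t0) (op_pow_calc hB t0) b0 (hb _ t02) jAX) _.
  rewrite ler_pM2l//.
  exact: (norm_mull hN hA (abs_powR_continuous s0) (op_pow_calc hA s0) a0 (ha _ s02) jX).
exists (b * (a * N X) + b * (a * N X)) => s s02.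
have s02' : 0 <= 2 - s <= 2 by lra.
have [s0 _] := andP s02; have [s0' _] := andP s02'.
apply/andP; split.
  by apply: (ideal_norm_ge0 hN); apply: (idealD hN); exact: jpow.
apply: le_trans (ideal_normD hJ (jpow s0 s0') (jpow s0' s0)) _.
by rewrite lerD// term.
Qed.

Let am_gm d Y : 0 <= d -> J Y ->
  2 * N (op_pow A d \o (Y \o op_pow B d)) <=
  N ((op_pow A d \o (op_pow A d \o Y)) + (Y \o (op_pow B d \o op_pow B d))).
Proof.
move=> d0; apply: (norm_am_gm hN hA hB (abs_powR_continuous d0) (abs_powR_continuous d0)).
- exact: abs_powR_ge0.
- exact: abs_powR_ge0.
- exact: op_pow_calc.
- exact: op_pow_calc.
Qed.

Lemma heinz_midpoint x y : 0 <= x <= 2 -> 0 <= y <= 2 ->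
  2 * h ((x + y) / 2) <= h x + h y.
Proof.
wlog xy : x y / x <= y.
  move=> H0 hx hy; have [xy|/ltW yx] := leP x y; first exact: H0.
  by rewrite addrC (addrC (h x)); exact: H0.
move=> x02 y02; pose d := (y - x) / 2.
have d0 : 0 <= d by rewrite /d; lra.
have x0 : 0 <= x by lra.
have y0 : 0 <= y by lra.
have y2 : 0 <= 2 - y by lra.
have x2 : 0 <= 2 - x by lra.
(* Chosen so that [A^d Y B^d] has the two terms of [h] at the midpoint, while [A^(2d) Y + Y B^(2d)],
   with [2 d = y - x], consists of the four terms of [h x] and [h y]. *)
pose Y := (op_pow A x \o X \o op_pow B (2 - y)) + (op_pow A (2 - y) \o X \o op_pow B x).
have jY : J Y by apply: (idealD hN); exact: jpow.
have lA s (s0 : 0 <= s) := op_pow_linear hA s0.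
have := am_gm d0 jY.
have -> : op_pow A d \o (Y \o op_pow B d) =
    (op_pow A ((x + y) / 2) \o X \o op_pow B (2 - (x + y) / 2)) +
    (op_pow A (2 - (x + y) / 2) \o X \o op_pow B ((x + y) / 2)).
  have e1 : (x + y) / 2 = d + x by rewrite /d; field.
  have e2 : 2 - (x + y) / 2 = d + (2 - y) by rewrite /d; field.
  apply/funext => u; rewrite /Y e2 e1 !opE /= (linear_mapD (lA _ d0)) !op_powD//.
  by rewrite (addrC (2 - y)) (addrC x).
have -> : (op_pow A d \o (op_pow A d \o Y)) + (Y \o (op_pow B d \o op_pow B d)) =
    ((op_pow A x \o X \o op_pow B (2 - x)) + (op_pow A (2 - x) \o X \o op_pow B x)) +
    ((op_pow A y \o X \o op_pow B (2 - y)) + (op_pow A (2 - y) \o X \o op_pow B y)).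
  have e1 : y = d + d + x by rewrite /d; field.
  have e2 : 2 - x = d + d + (2 - y) by rewrite /d; field.
  have dd : 0 <= d + d by exact: addr_ge0.
  have pA s u : 0 <= s -> op_pow A d (op_pow A d (op_pow A s u)) = op_pow A (d + d + s) u.
    by move=> s0; rewrite !op_powD//.
  have pB s u : 0 <= s -> op_pow B s (op_pow B d (op_pow B d u)) = op_pow B (d + d + s) u.
    by move=> s0; rewrite (op_powD hB u d0 d0) op_powD// addrC.
  apply/funext => u; rewrite /Y !opE /= !opE /= !(linear_mapD (lA _ d0)) !pA// !pB//.
  by rewrite -e2 -e1 (AC (2*2) ((3*2)*(1*4))).
move=> /le_trans; apply.
by apply: (ideal_normD hJ); apply: (idealD hN); exact: jpow.
Qed.

Lemma heinz_convex : convex_on h 0 2.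
Proof.
have [C hC] := heinz_bounded.
apply: (@midpoint_convex_bounded _ _ _ _ C).
  by move=> s /hC /andP[h0 h1]; rewrite ger0_norm.
by move=> x y; exact: heinz_midpoint.
Qed.

(** The point [r] is a convex combination of [p] and [2 - p], where [h] takes the same value. The
    case [p = 1] is separate because the weight has denominator [2 - 2 * p]. *)
Lemma heinz_antitone p r : 0 <= p -> p <= r <= 2 - p -> h r <= h p.
Proof.
move=> p0 pr; have [p1|p1] := eqVneq p 1.
  by have -> : r = p by lra.
have p1' : 0 < 2 - 2 * p.
  have : p < 1 by rewrite lt_neqAle p1; lra.
  lra.
pose l := (2 - p - r) / (2 - 2 * p).
have l01 : 0 <= l <= 1.
  rewrite /l; apply/andP; split; first by rewrite divr_ge0; lra.
  by rewrite ler_pdivrMr//; lra.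
have := @heinz_convex p (2 - p) l _ _ l01.
have -> : l * p + (1 - l) * (2 - p) = r by rewrite /l; field; rewrite gt_eqF.
rewrite heinz_sym => /(_ ltac:(lra) ltac:(lra)).
by rewrite -mulrDl subrKC mul1r.
Qed.

Lemma heinz1 : h 1 = 2 * N (A \o X \o B).
Proof.
rewrite /h /heinz_norm (_ : 2 - 1 = 1 :> R); last by ring.
rewrite (op_pow1 hA) (op_pow1 hB) -mulr2n -scaler_nat.
have -> : (2%:R : R[i]) = (2 : R)%:C by rewrite rmorph_nat.
rewrite (ideal_normZr hN) ?ger0_norm//.
by have := jpow ler01 ler01; rewrite (op_pow1 hA) (op_pow1 hB).
Qed.

Lemma heinz32_le :
  2 * h (3 / 2) <= N ((A \o A \o X) + (X \o B \o B) + 2%:C *: (A \o X \o B)).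
Proof.
have d0 : 0 <= 1 / 2 :> R by lra.
have [bA _ _] := hA; have [bB _ _] := hB.
have jY : J ((A \o X) + (X \o B)).
  by apply: (idealD hN); [exact: (ideal_compl hN)|exact: (ideal_compr hN)].
have lA : linear A by have [] := (bounded_opP _).1 bA.
have lX := ideal_linear_op hN jX.
have := am_gm d0 jY.
have h1 : 1 / 2 + 1 / 2 = 1 :> R by field.
have eA u : op_pow A (1 / 2) (op_pow A (1 / 2) u) = A u.
  by rewrite op_powD// h1 op_pow1.
have eB u : op_pow B (1 / 2) (op_pow B (1 / 2) u) = B u.
  by rewrite op_powD// h1 op_pow1.
have e3 (C : H -> H) (hC : positive_op C) u : op_pow C (3 / 2) u = op_pow C (1 / 2) (C u).
  have := op_powD hC u d0 ler01; rewrite (op_pow1 hC) => ->.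
  by congr (op_pow C _ u); field.
have e3' (C : H -> H) (hC : positive_op C) u : op_pow C (3 / 2) u = C (op_pow C (1 / 2) u).
  have := op_powD hC u ler01 d0; rewrite (op_pow1 hC) => ->.
  by congr (op_pow C _ u); field.
have e2 : 2 - 3 / 2 = 1 / 2 :> R by field.
move=> am; apply: le_trans (le_trans am _).
  rewrite /h /heinz_norm e2 ler_pM2l// le_eqVlt; apply/orP; left; apply/eqP; congr N.
  apply/funext => u; rewrite !opE /= (linear_mapD (op_pow_linear hA d0)).
  by rewrite (e3 A hA) (e3' B hB).
rewrite le_eqVlt; apply/orP; left; apply/eqP; congr N.
apply/funext => u; rewrite !opE /= !(linear_mapD (op_pow_linear hA d0)) !eA eB.
rewrite (_ : (2 : R)%:C = 2) ?rmorph_nat// scaler_nat mulr2n.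
by rewrite (AC (2*2) ((1*4)*(2*3))).
Qed.

End Heinz.

(** Arithmetic shared by the two cases: [a] and [b] stand for [h (3 / 2)] and [h r], [m] for the
    averaged integral, and [p] for [h] at the midpoint of the interval of integration in the
    variable of [h]. *)
Lemma chain_of_bounds (R : realType) (qt q2 d a m p b e : R) :
  q2 - d <= qt -> 4 * a - d <= q2 - d -> p <= m <= (a + b) / 2 ->
  b <= p -> b <= a -> e <= 4 * b - d ->
  q2 - d <= qt /\ 4 * a - d <= q2 - d /\ 2 * a + 2 * b - d <= 4 * a - d /\
  4 * m - d <= 2 * a + 2 * b - d /\ 4 * p - d <= 4 * m - d /\
  4 * b - d <= 4 * p - d /\ e <= 4 * b - d.
Proof. by move=> h1 h2 /andP[h3 h4] h5 h6 h7; do ![split] => //; lra. Qed.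

Theorem theorem2p1 (R : realType) (H : hilbertType R)
    (J : set (H -> H)) (N : (H -> H) -> R) (hN : unitarily_invariant_norm J N)
    (A B X : H -> H) (hA : positive_op A) (hB : positive_op B) (hX : J X)
    (t r : R) (ht : t <= 2) :
  let h := heinz_norm N A B X in
  let q (u : R) :=
    N ((A \o A \o X) + (X \o B \o B) + u%:C *: (A \o X \o B)) in
  let d := (4 - 2 * t) * N (A \o X \o B) in
  (1 / 2 <= r <= 1 ->
    2 * q t >= 2 * q 2 - d /\
    2 * q 2 - d >= 4 * h (3 / 2) - d /\
    4 * h (3 / 2) - d >= 2 * h (3 / 2) + 2 * h r - d /\
    2 * h (3 / 2) + 2 * h r - d >= 4 * mean_left h r - d /\
    4 * mean_left h r - d >= 4 * h ((2 * r + 1) / 4) - d /\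
    4 * h ((2 * r + 1) / 4) - d >= 4 * h r - d /\
    4 * h r - d >= (t + 2) * h r) /\
  (1 <= r <= 3 / 2 ->
    2 * q t >= 2 * q 2 - d /\
    2 * q 2 - d >= 4 * h (3 / 2) - d /\
    4 * h (3 / 2) - d >= 2 * h (3 / 2) + 2 * h r - d /\
    2 * h (3 / 2) + 2 * h r - d >= 4 * mean_right h r - d /\
    4 * mean_right h r - d >= 4 * h ((2 * r + 3) / 4) - d /\
    4 * h ((2 * r + 3) / 4) - d >= 4 * h r - d /\
    4 * h r - d >= (t + 2) * h r).
Proof.
move=> h q d.
have [bA _ _] := hA; have [bB _ _] := hB.
have [hJ _] := hN.
have jAX := ideal_compl hN bA hX.
have jAXB := ideal_compr hN bB jAX.
have jq u : J ((A \o A \o X) + (X \o B \o B) + u%:C *: (A \o X \o B)).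
  apply: (idealD hN); last exact: (idealZ hN).
  apply: (idealD hN); first exact: (ideal_compl hN (bounded_comp bA bA) hX).
  exact: (ideal_compr hN (bounded_comp bB bB) hX).
(* The operators in [q 2] and [q t] differ by [(2 - t) AXB], and [t <= 2] makes the norm of this
   difference [(2 - t) |||AXB|||]. *)
have c1 : 2 * q 2 - d <= 2 * q t.
  have : q 2 <= q t + (2 - t) * N (A \o X \o B).
    have t2 : 0 <= 2 - t by lra.
    rewrite -[2 - t](ger0_norm t2) -(ideal_normZr hN)//.
    apply: le_trans (ideal_normD hJ (jq t) (idealZ hN _ jAXB)).
    by rewrite -addrA -scalerDl -rmorphD subrKC.
  by rewrite /d; lra.
have c2 : 4 * h (3 / 2) - d <= 2 * q 2 - d.
  by have := heinz32_le hN hA hB hX; rewrite -/h /q; lra.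
have anti p s : 0 <= p -> p <= s <= 2 - p -> h s <= h p.
  exact: (heinz_antitone hN hA hB hX).
have sym s : h (2 - s) = h s by exact: heinz_sym.
have sym32 : h (1 / 2) = h (3 / 2).
  by rewrite -(sym (3 / 2)); congr h; field.
have le32 s : 1 / 2 <= s <= 3 / 2 -> h s <= h (3 / 2).
  by move=> s12; rewrite -sym32; apply: anti; lra.
have ge1 s : 1 / 2 <= s <= 3 / 2 -> h 1 <= h s.
  move=> s12; have [s1|s1] := leP s 1; first by apply: anti; lra.
  by rewrite -(sym s); apply: anti; lra.
(* The difference of the two sides is [(2 - t) (h r - 2 |||AXB|||)], which is nonnegative because
   [h 1 = 2 |||AXB|||] is the least value of [h]. *)
have c7 : 1 / 2 <= r <= 3 / 2 -> (t + 2) * h r <= 4 * h r - d.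
  move=> /ge1; rewrite /h (heinz1 hN hA hB hX) -/h => h1.
  have : (2 - t) * (2 * N (A \o X \o B)) <= (2 - t) * h r.
    by rewrite ler_wpM2l//; lra.
  by rewrite /d; lra.
have [C hC] := heinz_bounded hN hA hB hX.
have hconv := heinz_convex hN hA hB hX.
have half : 0 < 1 / 2 :> R by lra.
(* Convexity on the larger interval [[0, 2]] leaves a margin of [1 / 2] on each side, so [h] is
   Lipschitz up to the ends of [[1 / 2, 3 / 2]]. *)
have lip x y : 1 / 2 <= x <= 3 / 2 -> 1 / 2 <= y <= 3 / 2 ->
    `|h x - h y| <= C / (1 / 2) * `|x - y|.
  move=> hx hy; apply: (convex_lipschitz half hconv hC); lra.
have hconv' : convex_on h (1 / 2) (3 / 2).
  by move=> x y l hx hy hl; apply: hconv => //; lra.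
split=> hr.
  have r12 : 1 / 2 <= r <= 3 / 2 by lra.
  have hm := mean_left_bounds hconv' lip r12; rewrite sym32 in hm.
  have hp : h r <= h ((2 * r + 1) / 4) by apply: anti; lra.
  exact: chain_of_bounds c1 c2 hm hp (le32 _ r12) (c7 r12).
have r12 : 1 / 2 <= r <= 3 / 2 by lra.
have hm := mean_right_bounds hconv' lip r12; rewrite (addrC (h r)) in hm.
have hp : h r <= h ((2 * r + 3) / 4).
  (* The midpoint lies to the right of 1; its mirror image [(5 - 2 * r) / 4] is the left end of a
     symmetric interval containing [r]. *)
  by rewrite -(sym ((2 * r + 3) / 4)); apply: anti; lra.
exact: chain_of_bounds c1 c2 hm hp (le32 _ r12) (c7 r12).
Qed.
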